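(* Let $\alpha\ge 0$, $\beta\ge 0$, $\lambda\ge 0$, $\mu\ge 0$ be real numbers with $\lambda+\mu\ge 1$, let $0\le\gamma<1$, and let $\{a_k\}_{k=1}^{\infty}$ be a sequence of positive real numbers with $a_1=1$ satisfying: (1) $(2+\alpha)^{\lambda}(2+\beta)^{\mu}(3-\gamma)(3-2\gamma)a_3\le 2(2-\gamma)a_2\le a_1$; (2) $(k+1+\alpha)^{\lambda}(k+1+\beta)^{\mu}(k+2-\gamma)(k+2-2\gamma)a_{k+2}\le(k+\alpha)^{\lambda}(k+\beta)^{\mu}(k+1-\gamma)(k+1)a_{k+1}$ for all integers $k\ge 2$. Then for every $n\in\mathbb{N}$ the polynomial $f_n(z)=z+\sum_{k=2}^{n}a_kz^k$ is prestarlike of order $\gamma$. Moreover, $f(z)=z+\sum_{k=2}^{\infty}a_kz^k$ is prestarlike of order $\gamma$.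
   Context: $\mathbb{D}=\{z\in\mathbb{C}:|z|<1\}$. $\mathcal{A}_0$ is the class of analytic functions $f$ on $\mathbb{D}$ with $f(0)=0$ and $f'(0)=1$. For $0\le\gamma<1$, $\mathcal{S}^{\ast}(\gamma)$ is the class of $f\in\mathcal{A}_0$ with $\mathrm{Re}\left(\frac{zf'(z)}{f(z)}\right)>\gamma$ for all $z\in\mathbb{D}$ (value $1$ at $z=0$). The Hadamard product (convolution) of $f(z)=\sum_{k\ge0}a_kz^k$ and $g(z)=\sum_{k\ge0}b_kz^k$ is $(f\ast g)(z)=\sum_{k\ge0}a_kb_kz^k$. For $0\le\gamma<1$, a function $f\in\mathcal{A}_0$ is prestarlike of order $\gamma$ if $\frac{z}{(1-z)^{2-2\gamma}}\ast f(z)\in\mathcal{S}^{\ast}(\gamma)$. An empty sum is zero. *)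

(* Defs.v *)
From Stdlib Require Export Reals.
From Coquelicot Require Export Coquelicot.
Open Scope R_scope.

Definition unit_disc (z : C) : Prop := Cmod z < 1.

(* Complex functions are total maps [C -> C]; every notion below depends only
   on their values on the (open) unit disc. *)

(* Analyticity is complex differentiability at each point: the scalar field of
   the derivative is [C], not [R]. *)
Definition analytic_on_disc (f : C -> C) : Prop :=
  forall z : C, unit_disc z -> @ex_derive C_AbsRing C_NormedModule f z.

Definition class_A0 (f : C -> C) : Prop :=
  analytic_on_disc f /\ f (RtoC 0) = RtoC 0 /\ C_derive f (RtoC 0) = RtoC 1.

(* z f'(z) / f(z), with its removable singularity at 0 filled by 1 *)
Definition starlike_quotient (f : C -> C) (z : C) : C :=
  if Ceq_dec z (RtoC 0) then RtoC 1 else (z * C_derive f z / f z)%C.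

(* The nonvanishing condition is what makes the quotient meaningful: Rocq's
   division is total. *)
Definition starlike (gamma : R) (f : C -> C) : Prop :=
  class_A0 f /\
  (forall z : C, unit_disc z -> z <> RtoC 0 -> f z <> RtoC 0) /\
  (forall z : C, unit_disc z -> gamma < Re (starlike_quotient f z)).

(* [a] is the sequence of Taylor coefficients at 0 of [f], and the expansion
   holds on the whole disc. *)
Definition expansion_on_disc (a : nat -> C) (f : C -> C) : Prop :=
  forall z : C, unit_disc z -> @is_pseries C_AbsRing C_NormedModule a z (f z).

(* [h] is the Hadamard product of [f] and [g] on the disc. Coefficients of a
   power series being unique, this determines [h] on the disc. *)
Definition is_hadamard (f g h : C -> C) : Prop :=
  exists a b : nat -> C,
    expansion_on_disc a f /\ expansion_on_disc b g /\
    expansion_on_disc (fun k => (a k * b k)%C) h.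

Definition Cexp (z : C) : C := (exp (Re z) * cos (Im z), exp (Re z) * sin (Im z)).

(* principal argument, in (-PI, PI], of a nonzero complex number *)
Definition Carg (w : C) : R :=
  if Rle_dec 0 (Im w) then acos (Re w / Cmod w) else - acos (Re w / Cmod w).

Definition Clog (w : C) : C := (ln (Cmod w), Carg w).

(* principal branch of the power, for nonzero [w] *)
Definition Cpower (w : C) (p : R) : C := Cexp (RtoC p * Clog w)%C.

Definition prestarlike_kernel (gamma : R) (z : C) : C :=
  (z / Cpower (RtoC 1 - z) (2 - 2 * gamma))%C.

Definition prestarlike (gamma : R) (f : C -> C) : Prop :=
  class_A0 f /\
  exists h : C -> C, is_hadamard (prestarlike_kernel gamma) f h /\ starlike gamma h.

(* Sum of a complex series, total in the style of [RInt]: it is the sum when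
   the series converges. *)
Definition CSeries (u : nat -> C) : C :=
  iota (T := C_CompleteNormedModule)
    (@is_series C_AbsRing C_CompleteNormedModule u).

(* Main.v *)
Require Import Defs.
From Stdlib Require Import Reals Arith Lra Lia Psatz.
From Coquelicot Require Import Coquelicot.
Open Scope R_scope.

(** Let [c k] be the Taylor coefficients of the kernel [z / (1 - z) ^ (2 - 2 gamma)],
    so that [c (k + 1) = c k * (k + 1 - 2 gamma) / k].  The Hadamard product of the
    kernel with [f] is [h(z) = sum b_k z^k], [b_k = c_k a_k].  Set [Q = h / z] and let
    [P] be given by [z h' - gamma h = (1 - gamma) z P].  Then
    [z h' / h = gamma + (1 - gamma) P / Q], so [h] is starlike of order [gamma] as soon
    as [P / Q] has positive real part.  Here [P = 1 + sum_(k >= 1) y_k z^k] with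
    [y_k = (k + 1 - gamma) b_(k+1) / (1 - gamma)], and the two hypotheses on [a] say
    exactly that [y_1 <= 1], that [W_2 y_2 <= y_1] and that [W_k y_k] is nonincreasing
    for [k >= 2], where [W_k = (k + alpha)^lambda (k + beta)^mu].  The coefficients of [Q]
    are those of [P] times the nonincreasing factor [(1 - gamma) / (k + 1 - gamma)], so
    they obey the same conditions.

    The heart of the matter is that such a series takes the upper half disc into the first
    quadrant and the lower half disc into the fourth
    ([dominated_series_quadrant]).  Since [P(z)] and [Q(z)] then lie in the same quadrant,
    [Re (P / Q) > 0] ([Re_div_pos], [starlike_of_dominated]).  Replacing [y_k] by [y_k r^k]
    keeps the conditions, so the quadrant property is the nonnegativity of
    [y_1 + sum y_k cos kt] and of [sum y_k sin kt] for [0 <= t <= PI]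
    ([cosine_poly_nonneg], [sine_poly_nonneg]).  Both follow by summation by parts, except
    for sine sums at angles near [PI]: there the model case [y_k = 1 / k] leaves no
    room, because its even partial sums vanish to first order at [PI].  The general case
    is compared with it through the fact that all model sums at such angles lie between
    [0] and their first term ([alt_sine_sum_bounds]).

    The exponents matter only through [lambda + mu >= 1]: after scaling them to have sum
    [1], the weighted geometric mean [w_k] of [k + alpha] and [k + beta] satisfies
    [w_k >= k], and both [w_k] and [k / w_k] are nondecreasing
    ([tame_weight_of_log_weight]); the trigonometric estimates use only this.

    What remains is complex analysis: termwise differentiation of power series with bounded
    coefficients ([is_derive_pseries_C]), and the expansion of the kernel, obtained by
    differentiating [(1 - t z)^p] times the binomial series along the ray [t z]
    ([binomial_series_C]).  The polynomials are the case of a coefficient sequence that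
    ends in zeros. *)

(** * Trigonometric sums with slowly decaying coefficients *)

Lemma Rsum_Sr (f : nat -> R) (m n : nat) :
  (m <= S n)%nat -> sum_n_m f m (S n) = sum_n_m f m n + f (S n).
Proof. intros H; rewrite sum_n_Sm; auto. Qed.

Lemma Rsum_empty (f : nat -> R) (m n : nat) : (n < m)%nat -> sum_n_m f m n = 0.
Proof. intros H; rewrite sum_n_m_zero; auto. Qed.

Lemma Rsum_Chasles (f : nat -> R) (m k n : nat) :
  (m <= S k)%nat -> (k <= n)%nat ->
  sum_n_m f m n = sum_n_m f m k + sum_n_m f (S k) n.
Proof. intros H1 H2; rewrite (sum_n_m_Chasles f m k n); auto. Qed.

Lemma Rsum_scal (c : R) (f : nat -> R) (m n : nat) :
  sum_n_m (fun k => c * f k) m n = c * sum_n_m f m n.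
Proof. exact (sum_n_m_mult_l c f m n). Qed.

Lemma Rsum_ext (f g : nat -> R) (m n : nat) :
  (forall k, (m <= k <= n)%nat -> f k = g k) -> sum_n_m f m n = sum_n_m g m n.
Proof. exact (sum_n_m_ext_loc f g m n). Qed.

Lemma Rsum_nonneg (f : nat -> R) (m n : nat) :
  (forall k, (m <= k <= n)%nat -> 0 <= f k) -> 0 <= sum_n_m f m n.
Proof.
  induction n as [|n IH]; intros H.
  - destruct m as [|m].
    + rewrite sum_n_n. apply H; lia.
    + rewrite Rsum_empty by lia. lra.
  - destruct (le_lt_dec m (S n)) as [Hm|Hm].
    + rewrite Rsum_Sr by assumption.
      assert (0 <= sum_n_m f m n) by (apply IH; intros; apply H; lia).
      assert (0 <= f (S n)) by (apply H; lia). lra.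
    + rewrite Rsum_empty by assumption. lra.
Qed.

Lemma sum_split_first (f : nat -> R) (n : nat) :
  (1 <= n)%nat -> sum_n_m f 1 n = f 1%nat + sum_n_m f 2 n.
Proof.
  intros Hn. rewrite (Rsum_Chasles f 1 1 n) by lia. rewrite sum_n_n. reflexivity.
Qed.

(** Summation by parts: the coefficients of [B k + K >= 0] are the nonnegative
    decrements of [y], and only the first boundary term is negative. *)
Lemma abel_lower_bound (y B : nat -> R) (K : R) (M n : nat) :
  (forall k, (M <= k)%nat -> 0 <= y k) ->
  (forall k, (M <= k)%nat -> y (S k) <= y k) ->
  (forall k, (M <= k)%nat -> - K <= B k) ->
  - y M * (B M + K) <= sum_n_m (fun k => y k * (B (S k) - B k)) M n.
Proof.
  intros Hy Hd HB.
  destruct (le_lt_dec M n) as [Hn|Hn].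
  - assert (H : - y M * (B M + K) + y n * (B (S n) + K)
              <= sum_n_m (fun k => y k * (B (S k) - B k)) M n).
    { induction Hn as [|n Hn IH].
      - rewrite sum_n_n. lra.
      - rewrite Rsum_Sr by lia.
        assert (y (S n) * (B (S n) + K) <= y n * (B (S n) + K)).
        { apply Rmult_le_compat_r; [specialize (HB (S n)); specialize (HB ltac:(lia)); lra
                                   |apply Hd; lia]. }
        lra. }
    assert (0 <= y n * (B (S n) + K)).
    { apply Rmult_le_pos; [apply Hy; lia|].
      specialize (HB (S n) ltac:(lia)); lra. }
    lra.
  - rewrite Rsum_empty by assumption.
    assert (0 <= y M * (B M + K)).
    { apply Rmult_le_pos; [apply Hy; lia|]. specialize (HB M ltac:(lia)); lra. }
    lra.
Qed.

(** The derivative of [sin x - x cos x] is [x sin x]. *)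
Lemma x_cos_le_sin (x : R) : 0 <= x <= PI -> x * cos x <= sin x.
Proof.
  intros Hx.
  destruct (MVT_gen (fun t => sin t - t * cos t) 0 x (fun t => t * sin t))
    as [c [Hc Heq]].
  - intros t _. auto_derive; [exact I|ring].
  - intros t _. reg.
  - rewrite Rmin_left, Rmax_right in Hc by lra.
    rewrite sin_0, cos_0 in Heq.
    assert (0 <= sin c) by (apply sin_ge_0; lra).
    assert (0 <= c * sin c * (x - 0)).
    { apply Rmult_le_pos; [apply Rmult_le_pos|]; lra. }
    lra.
Qed.

(** The bound [x cos x <= sin x] at [x / 2], improved by doubling the angle. *)
Lemma sin_lower_half_angle (x : R) :
  0 <= x <= PI -> x * ((1 + cos x) / 2) <= sin x.
Proof.
  intros Hx.
  assert (Hc : cos x = 2 * (cos (x/2))^2 - 1).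
  { replace x with (2 * (x/2)) at 1 by field. rewrite cos_2a_cos. ring. }
  assert (Hs : sin x = 2 * sin (x/2) * cos (x/2)).
  { replace x with (2 * (x/2)) at 1 by field. rewrite sin_2a. ring. }
  assert (H := x_cos_le_sin (x/2) ltac:(lra)).
  assert (0 <= cos (x/2)) by (apply cos_ge_0; lra).
  rewrite Hc, Hs.
  replace (x * ((1 + (2 * cos (x / 2) ^ 2 - 1)) / 2))
    with (2 * (x/2 * cos (x/2)) * cos (x/2)) by field.
  apply Rmult_le_compat_r; lra.
Qed.

(** The constant is a rational lower bound for [cos (PI / 6) = sqrt 3 / 2]. *)
Lemma cos_half_ge (x : R) : 0 <= x <= PI / 3 -> 433 / 500 <= cos (x / 2).
Proof.
  intros Hx.
  assert (Hpi := PI_RGT_0).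
  assert (H : cos (PI / 6) <= cos (x / 2)) by (apply cos_decr_1; lra).
  rewrite cos_PI6 in H.
  assert (433 / 250 <= sqrt 3).
  { rewrite <- (sqrt_Rsqr (433/250)) by lra.
    apply sqrt_le_1_alt. unfold Rsqr. lra. }
  lra.
Qed.

Lemma triple_sin (x : R) : sin (3 * x) = 3 * sin x - 4 * sin x ^ 3.
Proof.
  replace (3 * x) with (2 * x + x) by ring.
  rewrite sin_plus, sin_2a, cos_2a_sin.
  assert (H := sin2_cos2 x). unfold Rsqr in H.
  replace (2 * sin x * cos x * cos x) with (2 * sin x * (1 - sin x * sin x))
    by (replace (1 - sin x * sin x) with (cos x * cos x) by lra; ring).
  ring.
Qed.

Lemma triple_cos (x : R) : cos (3 * x) = 4 * cos x ^ 3 - 3 * cos x.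
Proof.
  replace (3 * x) with (2 * x + x) by ring.
  rewrite cos_plus, sin_2a, cos_2a_cos.
  assert (H := sin2_cos2 x). unfold Rsqr in H.
  replace (2 * sin x * cos x * sin x) with (2 * cos x * (1 - cos x * cos x))
    by (replace (1 - cos x * cos x) with (sin x * sin x) by lra; ring).
  ring.
Qed.

(** The polynomial is [(1 - s) (4 s^2 + 4 s - 1)].  It is the worst case, [y_2 = y_1 / 2]
    and the tail at its lower bound, of both the cosine sum (with [s = sin (t / 2)]) and
    the sine sum (with [s = cos (t / 2)]). *)
Lemma half_angle_cubic (s : R) : 1 / 2 <= s <= 1 -> 0 <= 5 * s - 4 * s ^ 3 - 1.
Proof.
  intros Hs. replace (5 * s - 4 * s ^ 3 - 1) with ((1 - s) * (4 * s * s + 4 * s - 1)) by ring.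
  apply Rmult_le_pos; nra.
Qed.

Lemma two_sin_half_mul_cos (t : R) (k : nat) :
  2 * sin (t / 2) * cos (INR k * t)
  = sin ((INR (S k) - 1/2) * t) - sin ((INR k - 1/2) * t).
Proof.
  rewrite S_INR.
  replace ((INR k + 1 - 1/2) * t) with (INR k * t + t/2) by field.
  replace ((INR k - 1/2) * t) with (INR k * t - t/2) by field.
  rewrite sin_plus, sin_minus. ring.
Qed.

Lemma two_sin_half_mul_sin (t : R) (k : nat) :
  2 * sin (t / 2) * sin (INR k * t)
  = - cos ((INR (S k) - 1/2) * t) - - cos ((INR k - 1/2) * t).
Proof.
  rewrite S_INR.
  replace ((INR k + 1 - 1/2) * t) with (INR k * t + t/2) by field.
  replace ((INR k - 1/2) * t) with (INR k * t - t/2) by field.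
  rewrite cos_plus, cos_minus. ring.
Qed.

(** The [k]-th term of the sine series [sum sin (k t) / k] at [t = PI - phi], whose sum is
    [phi / 2]. *)
Definition alt_sine_term (phi : R) (k : nat) : R :=
  - (-1) ^ k * sin (INR k * phi) / INR k.

Lemma sin_mult_PI_minus (phi : R) (k : nat) :
  sin (INR k * (PI - phi)) = - (-1) ^ k * sin (INR k * phi).
Proof.
  assert (H : sin (INR k * (PI - phi)) = - (-1) ^ k * sin (INR k * phi)
           /\ cos (INR k * (PI - phi)) = (-1) ^ k * cos (INR k * phi)).
  { induction k as [|k [IHs IHc]].
    - simpl. rewrite !Rmult_0_l, sin_0, cos_0. lra.
    - rewrite S_INR, !Rmult_plus_distr_r, !Rmult_1_l.
      rewrite !sin_plus, !cos_plus, IHs, IHc, Rtrigo_facts.sin_pi_minus,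
        Rtrigo_facts.cos_pi_minus. simpl. split; ring. }
  apply H.
Qed.

Lemma alternating_sum_bounds (f : nat -> R) (m : nat) :
  (1 <= m)%nat ->
  (forall k, (1 <= k <= m)%nat -> 0 <= f k) ->
  (forall k, (1 <= k < m)%nat -> f (S k) <= f k) ->
  0 <= sum_n_m (fun k => - (-1) ^ k * f k) 1 m <= f 1%nat.
Proof.
  intros Hm Hpos Hdec.
  (* odd partial sums stay above the last term added, even ones below the first term
     minus the last: this leaves room for the next term *)
  assert (H : forall n, (1 <= n <= m)%nat ->
     let s := sum_n_m (fun k => - (-1) ^ k * f k) 1 n in
     ((-1) ^ n = -1 /\ f n <= s <= f 1%nat) \/ ((-1) ^ n = 1 /\ 0 <= s <= f 1%nat - f n)).
  { intros n [Hn1 Hn2]. induction Hn1 as [|n Hn IH].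
    - left. cbv zeta. rewrite sum_n_n. simpl. lra.
    - specialize (IH ltac:(lia)). cbv zeta in *.
      rewrite Rsum_Sr by lia.
      set (s := sum_n_m _ 1 n) in *.
      assert (H1 := Hpos (S n) ltac:(lia)). assert (H2 := Hdec n ltac:(lia)).
      simpl. destruct IH as [[E IH]|[E IH]]; rewrite E; [right|left]; lra. }
  specialize (H m ltac:(lia)). cbv zeta in H.
  assert (H1 := Hpos m ltac:(lia)).
  set (s := sum_n_m _ 1 m) in *. lra.
Qed.

(** By the addition formula this reduces to [k cos (k phi) sin phi <= sin (k phi)], which
    follows from [x cos x <= sin x] at [x = k phi]. *)
Lemma sin_over_k_decreasing (phi : R) (k : nat) :
  (1 <= k)%nat -> 0 <= phi -> INR (S k) * phi <= PI ->
  sin (INR (S k) * phi) / INR (S k) <= sin (INR k * phi) / INR k.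
Proof.
  intros Hk Hphi Hle.
  assert (Hk0 : 1 <= INR k) by (change 1 with (INR 1); apply le_INR; assumption).
  rewrite S_INR in *.
  assert (Hkp : 0 <= INR k * phi <= PI) by nra.
  assert (Hs : 0 <= sin (INR k * phi)) by (apply sin_ge_0; lra).
  assert (Hsp : 0 <= sin phi) by (apply sin_ge_0; nra).
  assert (Hmain : INR k * (cos (INR k * phi) * sin phi) <= sin (INR k * phi)).
  { destruct (Rle_lt_dec (cos (INR k * phi)) 0) as [Hc|Hc].
    - assert (0 <= - cos (INR k * phi) * sin phi) by (apply Rmult_le_pos; lra). nra.
    - assert (H := x_cos_le_sin _ Hkp).
      assert (sin phi <= phi).
      { destruct (Req_dec phi 0) as [->|]; [rewrite sin_0; lra|]. left; apply sin_lt_x; lra. }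
      assert (cos (INR k * phi) * sin phi <= cos (INR k * phi) * phi)
        by (apply Rmult_le_compat_l; lra).
      nra. }
  replace ((INR k + 1) * phi) with (INR k * phi + phi) by ring.
  rewrite sin_plus.
  assert (Hcp := COS_bound phi).
  assert (INR k * (sin (INR k * phi) * cos phi) <= INR k * (sin (INR k * phi) * 1)).
  { apply Rmult_le_compat_l; [lra|]. apply Rmult_le_compat_l; lra. }
  apply Rmult_le_reg_r with (INR k * (INR k + 1)); [nra|].
  replace ((sin (INR k * phi) * cos phi + cos (INR k * phi) * sin phi) / (INR k + 1) *
     (INR k * (INR k + 1)))
    with (INR k * (sin (INR k * phi) * cos phi) + INR k * (cos (INR k * phi) * sin phi))
    by (field; lra).
  replace (sin (INR k * phi) / INR k * (INR k * (INR k + 1)))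
    with (INR k * (sin (INR k * phi) * 1) + sin (INR k * phi)) by (field; lra).
  lra.
Qed.

Lemma pow_opp1_cases (m : nat) : (-1) ^ m = 1 \/ (-1) ^ m = -1.
Proof. induction m as [|m [IH|IH]]; simpl; [lra| |]; rewrite IH; lra. Qed.

Lemma alt_cosine_sum (t : R) (m : nat) :
  2 * cos (t / 2) * sum_n_m (fun k => - (-1) ^ k * cos (INR k * t)) 1 m
  = cos (t / 2) - (-1) ^ m * cos ((INR m + 1 / 2) * t).
Proof.
  induction m as [|m IH].
  - rewrite Rsum_empty by lia. simpl. replace ((0 + 1 / 2) * t) with (t / 2) by field. ring.
  - rewrite Rsum_Sr, Rmult_plus_distr_l, IH, S_INR by lia.
    replace ((INR m + 1 + 1 / 2) * t) with ((INR m + 1) * t + t / 2) by field.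
    replace ((INR m + 1 / 2) * t) with ((INR m + 1) * t - t / 2) by field.
    rewrite cos_plus, cos_minus. simpl. ring.
Qed.

Lemma is_derive_alt_sine_sum (t : R) (m : nat) :
  is_derive (fun x => sum_n_m (alt_sine_term x) 1 m) t
    (sum_n_m (fun k => - (-1) ^ k * cos (INR k * t)) 1 m).
Proof.
  induction m as [|m IH].
  - apply (is_derive_ext (fun _ => 0)).
    + intros x. rewrite Rsum_empty by lia. reflexivity.
    + rewrite Rsum_empty by lia. apply (is_derive_const (V := R_NormedModule)).
  - apply (is_derive_ext (fun x => sum_n_m (alt_sine_term x) 1 m + alt_sine_term x (S m))).
    + intros x. rewrite Rsum_Sr by lia. reflexivity.
    + rewrite Rsum_Sr by lia.
      apply (is_derive_plus (V := R_NormedModule)); [exact IH|].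
      unfold alt_sine_term.
      assert (Hc : INR (S m) <> 0) by (apply not_0_INR; lia).
      generalize dependent (INR (S m)). generalize ((-1) ^ S m). intros e c Hc.
      auto_derive; [exact I|]. field. exact Hc.
Qed.

Lemma le_of_derive_le (f g f' g' : R -> R) (a b : R) :
  a <= b ->
  (forall t, a <= t <= b -> is_derive f t (f' t)) ->
  (forall t, a <= t <= b -> is_derive g t (g' t)) ->
  (forall t, a <= t <= b -> f' t <= g' t) ->
  f b - f a <= g b - g a.
Proof.
  intros Hab Hf Hg Hle.
  assert (Hd : forall t, a <= t <= b -> is_derive (fun x => g x - f x) t (g' t - f' t)).
  { intros t Ht. apply (is_derive_minus (V := R_NormedModule)); auto. }
  destruct (MVT_gen (fun x => g x - f x) a b (fun x => g' x - f' x)) as (c & Hc & E).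
  - rewrite Rmin_left, Rmax_right by assumption. intros; apply Hd; lra.
  - rewrite Rmin_left, Rmax_right by assumption. intros t Ht.
    apply continuity_pt_filterlim.
    apply (ex_derive_continuous (fun x => g x - f x)). eexists; apply Hd; assumption.
  - rewrite Rmin_left, Rmax_right in Hc by assumption.
    specialize (Hle c Hc). nra.
Qed.

(** Differentiating the sum gives a Dirichlet kernel, whose oscillating part is, up to a
    small error, the derivative of [sin (N t) / (2 N cos (t / 2))] with [N = m + 1 / 2].
    The error is dominated by the derivative of [1 / (2 N cos (t / 2))]. *)
Lemma alt_sine_sum_close (phi : R) (m : nat) :
  0 <= phi <= PI / 3 ->
  Rabs (sum_n_m (alt_sine_term phi) 1 m - phi / 2)
    <= (2 / cos (phi / 2) - 1) / (2 * INR m + 1).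
Proof.
  intros Hphi. assert (Hpi := PI_RGT_0). assert (Hm := pos_INR m).
  set (N := INR m + 1 / 2). assert (HN : 0 < N) by (unfold N; lra).
  set (H := fun t => sum_n_m (alt_sine_term t) 1 m - t / 2
              + (-1) ^ m * sin (N * t) / (2 * N * cos (t / 2))).
  set (H' := fun t => (-1) ^ m * sin (N * t) * sin (t / 2) / (4 * N * cos (t / 2) ^ 2)).
  set (g := fun t => / (2 * N * cos (t / 2))).
  set (g' := fun t => sin (t / 2) / (4 * N * cos (t / 2) ^ 2)).
  assert (Hcos : forall t, 0 <= t <= phi -> 0 < cos (t / 2)).
  { intros t Ht. assert (H1 := cos_half_ge t ltac:(lra)). lra. }
  assert (HdH : forall t, 0 <= t <= phi -> is_derive H t (H' t)).
  { intros t Ht. specialize (Hcos t Ht). unfold H.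
    assert (Hd := is_derive_alt_sine_sum t m).
    assert (Hs := alt_cosine_sum t m). fold N in Hs.
    set (S1 := sum_n_m _ 1 m) in *.
    replace (H' t) with (S1 + (- / 2 + (-1) ^ m * (cos (N * t) / (2 * cos (t / 2))
        + sin (N * t) * sin (t / 2) / (4 * N * cos (t / 2) ^ 2)))).
    - apply (is_derive_ext (fun t => sum_n_m (alt_sine_term t) 1 m
          + (- (t / 2) + (-1) ^ m * sin (N * t) / (2 * N * cos (t / 2))))).
      { intros x. unfold Rminus. rewrite Rplus_assoc. reflexivity. }
      apply (is_derive_plus (V := R_NormedModule)); [exact Hd|].
      auto_derive; change (t * / 2) with (t / 2).
      + apply Rgt_not_eq, Rmult_lt_0_compat; lra.
      + field. lra.
    - unfold H'. replace S1 with ((cos (t / 2) - (-1) ^ m * cos (N * t)) / (2 * cos (t / 2))).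
      + field. lra.
      + rewrite <- Hs. field. lra. }
  assert (Hdg : forall t, 0 <= t <= phi -> is_derive g t (g' t)).
  { intros t Ht. specialize (Hcos t Ht). unfold g, g'.
    auto_derive; change (t * / 2) with (t / 2).
    - apply Rgt_not_eq, Rmult_lt_0_compat; lra.
    - field. lra. }
  assert (Hbound : forall t, 0 <= t <= phi -> - g' t <= H' t <= g' t).
  { intros t Ht. specialize (Hcos t Ht).
    assert (Hk : 0 <= g' t).
    { apply Rmult_le_pos; [apply sin_ge_0; lra|].
      left. apply Rinv_0_lt_compat.
      apply Rmult_lt_0_compat; [lra|]. apply pow_lt. exact Hcos. }
    replace (H' t) with ((-1) ^ m * sin (N * t) * g' t) by (unfold H', g'; field; lra).
    assert (Hb := SIN_bound (N * t)).
    destruct (pow_opp1_cases m) as [-> | ->]; nra. }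
  assert (HH0 : H 0 = 0).
  { unfold H. rewrite Rmult_0_r, sin_0.
    replace (sum_n_m (alt_sine_term 0) 1 m) with 0; [unfold Rdiv; ring|].
    symmetry. rewrite (Rsum_ext _ (fun k => 0 * 0)).
    - rewrite Rsum_scal. apply Rmult_0_l.
    - intros k _. unfold alt_sine_term. rewrite Rmult_0_r, sin_0. unfold Rdiv. ring. }
  assert (Hup := le_of_derive_le H g H' g' 0 phi ltac:(lra) HdH Hdg
            ltac:(intros; apply Hbound; assumption)).
  assert (Hlo := le_of_derive_le (fun t => - g t) H (fun t => - g' t) H' 0 phi ltac:(lra)
            ltac:(intros; apply (is_derive_opp (V := R_NormedModule)); apply Hdg; assumption)
            HdH ltac:(intros; apply Hbound; assumption)).
  cbv beta in Hlo. rewrite HH0 in *.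
  assert (Eg0 : g 0 = / (2 * N)).
  { unfold g. unfold Rdiv. rewrite Rmult_0_l, cos_0, Rmult_1_r. reflexivity. }
  assert (Hc := Hcos phi ltac:(lra)).
  assert (Hsmall : - g phi <= (-1) ^ m * sin (N * phi) / (2 * N * cos (phi / 2)) <= g phi).
  { assert (Hb := SIN_bound (N * phi)).
    assert (0 < g phi).
    { apply Rinv_0_lt_compat. apply Rmult_lt_0_compat; lra. }
    change ((-1) ^ m * sin (N * phi) / (2 * N * cos (phi / 2)))
      with ((-1) ^ m * sin (N * phi) * g phi).
    destruct (pow_opp1_cases m) as [-> | ->]; nra. }
  replace ((2 / cos (phi / 2) - 1) / (2 * INR m + 1)) with (2 * g phi - g 0).
  2: { rewrite Eg0. unfold g. replace (2 * INR m + 1) with (2 * N) by (unfold N; field).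
       field. lra. }
  apply Rabs_le.
  unfold H in Hup, Hlo. set (s := sum_n_m _ 1 m) in *. lra.
Qed.

(** While [m phi <= PI] this is an alternating sum with decreasing terms.  Afterwards [m] is
    so large that the sum is close to its limit [phi / 2], well inside the interval. *)
Lemma alt_sine_sum_bounds (phi : R) (m : nat) :
  0 <= phi <= PI / 3 -> (1 <= m)%nat ->
  0 <= sum_n_m (alt_sine_term phi) 1 m <= sin phi.
Proof.
  intros Hphi Hm. assert (Hpi := PI_RGT_0). assert (Hpi3 := PI2_3_2).
  destruct (Rle_lt_dec (INR m * phi) PI) as [H|H].
  - assert (HA := alternating_sum_bounds (fun k => sin (INR k * phi) / INR k) m Hm).
    cbv beta in HA. replace (sin (INR 1 * phi) / INR 1) with (sin phi) in HA
      by (simpl; rewrite Rmult_1_l; field).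
    rewrite (Rsum_ext (alt_sine_term phi) (fun k => - (-1) ^ k * (sin (INR k * phi) / INR k))).
    2: { intros k _. unfold alt_sine_term, Rdiv. ring. }
    assert (Hle : forall k, (k <= m)%nat -> INR k * phi <= PI).
    { intros k Hk. apply le_INR in Hk. assert (0 <= INR k) by apply pos_INR. nra. }
    apply HA.
    + intros k Hk. assert (0 < INR k) by (apply lt_0_INR; lia).
      apply Rmult_le_pos; [|left; apply Rinv_0_lt_compat; assumption].
      apply sin_ge_0; [nra|]. apply Hle; lia.
    + intros k Hk. apply sin_over_k_decreasing; [lia|lra|apply Hle; lia].
  - assert (Hc := alt_sine_sum_close phi m Hphi).
    assert (Hch := cos_half_ge phi Hphi).
    assert (Hs : phi * (3/4) <= sin phi).
    { assert (Hs := sin_lower_half_angle phi ltac:(lra)).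
      assert (1/2 <= cos phi).
      { rewrite <- cos_PI3. apply cos_decr_1; lra. }
      nra. }
    assert (Hb : (2 / cos (phi / 2) - 1) / (2 * INR m + 1) <= phi / 4).
    { assert (Hm0 := pos_INR m).
      apply Rmult_le_reg_r with (2 * INR m + 1); [lra|].
      unfold Rdiv at 1. rewrite Rmult_assoc, Rinv_l, Rmult_1_r by lra.
      assert (2 / cos (phi / 2) <= 2 * (500 / 433)).
      { apply Rmult_le_compat_l; [lra|].
        replace (500/433) with (/ (433/500)) by field.
        apply Rinv_le_contravar; lra. }
      nra. }
    apply Rabs_le_between in Hc.
    set (s := sum_n_m _ 1 m) in *. lra.
Qed.

(** The last condition says that [k / w k] is nondecreasing.  The model is [w k = k + s]
    with [s >= 0]. *)
Definition tame_weight (w : nat -> R) : Prop :=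
  forall k, (2 <= k)%nat ->
    INR k <= w k /\ w k <= w (S k) /\ INR k * w (S k) <= INR (S k) * w k.

(** The weight acts from index 2 on only: the passage from [y 1] to [y 2] loses the
    factor [w 2], not [w 2 / w 1].  This is what makes the sine sums nonnegative near [PI]. *)
Definition dominated (w y : nat -> R) : Prop :=
  (forall k, (1 <= k)%nat -> 0 <= y k) /\
  w 2%nat * y 2%nat <= y 1%nat /\
  (forall k, (2 <= k)%nat -> w (S k) * y (S k) <= w k * y k).

Section Dominated.

Variables w y : nat -> R.
Hypothesis Hw : tame_weight w.
Hypothesis Hy : dominated w y.

Lemma weight_ge_2 (k : nat) : (2 <= k)%nat -> 2 <= w k.
Proof.
  intros Hk. destruct (Hw k Hk) as [H _].
  apply Rle_trans with (2 := H). replace 2 with (INR 2) by (simpl; ring).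
  apply le_INR; assumption.
Qed.

Lemma dominated_weighted_le (k : nat) : (2 <= k)%nat -> w k * y k <= w 2%nat * y 2%nat.
Proof.
  destruct Hy as (_ & _ & H3).
  induction 1 as [|k Hk IH]; [lra|]. specialize (H3 k Hk). lra.
Qed.

Lemma dominated_INR_le (k : nat) : (1 <= k)%nat -> INR k * y k <= y 1%nat.
Proof.
  intros Hk. destruct Hy as (H1 & H2 & H3).
  destruct (le_lt_dec 2 k) as [H|H].
  - assert (INR k * y k <= w k * y k).
    { apply Rmult_le_compat_r; [apply H1; lia|apply Hw, H]. }
    assert (Hq := dominated_weighted_le k H). lra.
  - replace k with 1%nat by lia. simpl; lra.
Qed.

Lemma dominated_decreasing (k : nat) : (1 <= k)%nat -> y (S k) <= y k.
Proof.
  intros Hk. destruct Hy as (H1 & H2 & H3).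
  destruct (le_lt_dec 2 k) as [H|H].
  - assert (Hk2 := weight_ge_2 k H).
    destruct (Hw k H) as (_ & Hm & _).
    assert (w k * y (S k) <= w (S k) * y (S k)).
    { apply Rmult_le_compat_r; [apply H1; lia|assumption]. }
    specialize (H3 k H).
    apply Rmult_le_reg_l with (w k); lra.
  - replace k with 1%nat by lia.
    assert (Hk2 := weight_ge_2 2 ltac:(lia)).
    specialize (H1 2%nat ltac:(lia)). nra.
Qed.

Lemma dominated_second_le_half : y 2%nat <= y 1%nat / 2.
Proof. assert (H := dominated_INR_le 2 ltac:(lia)). simpl in H. lra. Qed.

(** [2 sin (t / 2) cos (k t)] is a difference of sines, to which summation by parts applies. *)
Lemma cosine_tail_lower_bound (t : R) (M n : nat) :
  (1 <= M)%nat ->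
  - y M * (sin ((INR M - 1/2) * t) + 1)
  <= 2 * sin (t / 2) * sum_n_m (fun k => y k * cos (INR k * t)) M n.
Proof.
  intros HM.
  rewrite <- Rsum_scal.
  rewrite (Rsum_ext _ (fun k => y k * (sin ((INR (S k) - 1/2) * t) - sin ((INR k - 1/2) * t)))).
  2: { intros k _. rewrite <- two_sin_half_mul_cos. ring. }
  apply (abel_lower_bound y (fun k => sin ((INR k - 1/2) * t))).
  - intros; apply Hy; lia.
  - intros; apply dominated_decreasing; lia.
  - intros; apply SIN_bound.
Qed.

Lemma sine_tail_lower_bound (t : R) (M n : nat) :
  (1 <= M)%nat ->
  - y M * (1 - cos ((INR M - 1/2) * t))
  <= 2 * sin (t / 2) * sum_n_m (fun k => y k * sin (INR k * t)) M n.
Proof.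
  intros HM.
  rewrite <- Rsum_scal.
  rewrite (Rsum_ext _ (fun k => y k * (- cos ((INR (S k) - 1/2) * t) - - cos ((INR k - 1/2) * t)))).
  2: { intros k _. rewrite <- two_sin_half_mul_sin. ring. }
  replace (1 - cos ((INR M - 1/2) * t)) with (- cos ((INR M - 1/2) * t) + 1) by ring.
  apply (abel_lower_bound y (fun k => - cos ((INR k - 1/2) * t))).
  - intros; apply Hy; lia.
  - intros; apply dominated_decreasing; lia.
  - intros k _. assert (H := COS_bound ((INR k - 1/2) * t)). lra.
Qed.

Lemma cosine_poly_large_angle (t : R) (n : nat) :
  PI / 3 <= t <= PI -> (1 <= n)%nat ->
  0 <= y 1%nat + sum_n_m (fun k => y k * cos (INR k * t)) 1 n.
Proof.
  intros Ht Hn. assert (Hpi := PI_RGT_0).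
  rewrite sum_split_first by assumption.
  set (T := sum_n_m _ 2 n).
  assert (HT := cosine_tail_lower_bound t 2 n ltac:(lia)). fold T in HT.
  assert (Hs1 : 1/2 <= sin (t/2)).
  { rewrite <- sin_PI6. apply sin_incr_1; lra. }
  assert (Hs2 := SIN_bound (t/2)).
  assert (H1 := half_angle_cubic (sin (t/2)) ltac:(lra)).
  assert (Hy2 := dominated_second_le_half).
  assert (H2 : 0 <= y 2%nat) by (apply Hy; lia).
  replace (INR 1 * t) with (2 * (t/2)) by (simpl; field).
  replace ((INR 2 - 1/2) * t) with (3 * (t/2)) in HT by (simpl; field).
  rewrite triple_sin in HT. rewrite cos_2a_sin.
  set (s := sin (t/2)) in *.
  apply Rmult_le_reg_l with (2 * s); [lra|].
  rewrite Rmult_0_r.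
  assert (y 2%nat * (3 * s - 4 * s ^ 3 + 1) <= y 1%nat / 2 * (3 * s - 4 * s ^ 3 + 1)).
  { apply Rmult_le_compat_r; [|lra].
    replace (3 * s - 4 * s ^ 3 + 1) with ((1 - s) * (4 * s * s + 4*s + 1)) by ring.
    apply Rmult_le_pos; nra. }
  assert (0 <= y 1%nat * (5 * s - 4 * s ^ 3 - 1)) by (apply Rmult_le_pos; lra).
  nra.
Qed.

Lemma sine_poly_small_angle (t : R) (n : nat) :
  0 < t <= 2 * PI / 3 -> (1 <= n)%nat ->
  0 <= sum_n_m (fun k => y k * sin (INR k * t)) 1 n.
Proof.
  intros Ht Hn. assert (Hpi := PI_RGT_0).
  rewrite sum_split_first by assumption.
  set (T := sum_n_m _ 2 n).
  assert (HT := sine_tail_lower_bound t 2 n ltac:(lia)). fold T in HT.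
  assert (Hs1 : 1/2 <= cos (t/2)).
  { rewrite <- cos_PI3. apply cos_decr_1; lra. }
  assert (Hs2 := COS_bound (t/2)).
  assert (Hs : 0 < sin (t/2)) by (apply sin_gt_0; lra).
  assert (H1 := half_angle_cubic (cos (t/2)) ltac:(lra)).
  assert (Hy2 := dominated_second_le_half).
  assert (H2 : 0 <= y 2%nat) by (apply Hy; lia).
  replace (INR 1 * t) with (2 * (t/2)) by (simpl; field).
  replace ((INR 2 - 1/2) * t) with (3 * (t/2)) in HT by (simpl; field).
  rewrite triple_cos in HT. rewrite sin_2a.
  assert (Hsc := sin2_cos2 (t/2)). unfold Rsqr in Hsc.
  set (s := sin (t/2)) in *. set (c := cos (t/2)) in *.
  apply Rmult_le_reg_l with (2 * s); [lra|].
  rewrite Rmult_0_r.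
  assert (y 2%nat * (1 - (4 * c ^ 3 - 3 * c)) <= y 1%nat / 2 * (1 - (4 * c ^ 3 - 3 * c))).
  { apply Rmult_le_compat_r; [|lra].
    replace (1 - (4 * c ^ 3 - 3 * c)) with ((1 - c) * (4 * c * c + 4*c + 1)) by ring.
    apply Rmult_le_pos; nra. }
  assert (0 <= y 1%nat * (5 * c - 4 * c ^ 3 - 1)) by (apply Rmult_le_pos; lra).
  replace (2 * s * (y 1%nat * (2 * s * c) + T))
    with (4 * (1 - c * c) * c * y 1%nat + 2 * s * T) by (replace (1 - c*c) with (s*s) by lra; ring).
  nra.
Qed.

(** The terms with [k t <= PI / 2] are nonnegative.  If [K] is the first later index, then
    [y_K <= y_1 / K <= 2 t y_1 / PI], so that the tail costs less than [1 + cos t >= 3 / 2]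
    times [y_1]. *)
Lemma cosine_poly_small_angle (t : R) (n : nat) :
  0 < t <= PI / 3 -> (1 <= n)%nat ->
  0 <= y 1%nat + sum_n_m (fun k => y k * cos (INR k * t)) 1 n.
Proof.
  intros Ht Hn. assert (Hpi := PI_RGT_0). assert (Hpi3 := PI2_3_2).
  rewrite sum_split_first by assumption.
  set (f := fun k => y k * cos (INR k * t)).
  assert (Hc1 : 1/2 <= cos (INR 1 * t)).
  { rewrite <- cos_PI3. apply cos_decr_1; simpl; lra. }
  assert (Hs : 0 < sin (t/2)) by (apply sin_gt_0; lra).
  assert (Hsin : t / 2 * (933/1000) <= sin (t/2)).
  { assert (H := sin_lower_half_angle (t/2) ltac:(lra)).
    assert (Hc := cos_half_ge t ltac:(lra)). nra. }
  assert (Hy1 : 0 <= y 1%nat) by (apply Hy; lia).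
  (* M is the last index with M t <= PI / 2, capped at n, and at least 1 *)
  assert (Hex : exists M, (1 <= M <= n)%nat /\ (forall k, (2 <= k <= M)%nat -> INR k * t <= PI / 2)
      /\ ((M < n)%nat -> PI / 2 < INR (S M) * t)).
  { clear - Hn. induction Hn as [|n Hn IH].
    - exists 1%nat. split; [lia|]. split; [intros; lia|]. lia.
    - destruct IH as (M & HM1 & HM2 & HM3).
      destruct (le_lt_dec n M) as [H|H].
      + replace M with n in * by lia.
        destruct (Rle_lt_dec (INR (S n) * t) (PI / 2)) as [H'|H'].
        * exists (S n). split; [lia|]. split; [|lia].
          intros k Hk. destruct (le_lt_dec k n); [apply HM2; lia|].
          replace k with (S n) by lia. assumption.
        * exists n. split; [lia|]. split; [assumption|]. auto.
      + exists M. split; [lia|]. split; auto. }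
  destruct Hex as (M & HM & HM1 & HM2).
  rewrite (Rsum_Chasles f 2 M n) by lia.
  assert (Hhead : 0 <= sum_n_m f 2 M).
  { apply Rsum_nonneg. intros k Hk. unfold f.
    apply Rmult_le_pos; [apply Hy; lia|].
    apply cos_ge_0; [|apply HM1; lia].
    assert (0 <= INR k) by apply pos_INR. nra. }
  assert (Htail : - (3/2) * y 1%nat <= sum_n_m f (S M) n).
  { destruct (le_lt_dec n M) as [H|H].
    { rewrite Rsum_empty by lia. lra. }
    assert (HT := cosine_tail_lower_bound t (S M) n ltac:(lia)). fold f in HT.
    specialize (HM2 H).
    assert (Hyk := dominated_INR_le (S M) ltac:(lia)).
    assert (Hyk0 : 0 <= y (S M)) by (apply Hy; lia).
    assert (HB := SIN_bound ((INR (S M) - 1/2) * t)).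
    set (S1 := sum_n_m f (S M) n) in *. set (s := sin (t/2)) in *.
    assert (HT' : - y (S M) <= s * S1) by nra.
    set (m := INR (S M)) in *. set (q := y (S M)) in *.
    (* m t > PI / 2 > 3 / 2 gives q <= 2 t y_1 / 3, while s >= 0.4665 t *)
    assert (Hq : q * (3/2) <= y 1%nat * t).
    { assert (3/2 <= m * t) by lra.
      assert (q * (3/2) <= q * (m * t)) by (apply Rmult_le_compat_l; lra).
      assert (m * q * t <= y 1%nat * t) by (apply Rmult_le_compat_r; lra).
      nra. }
    apply Rmult_le_reg_l with s; [assumption|].
    assert (y 1%nat * (t / 2 * (933/1000)) <= y 1%nat * s) by (apply Rmult_le_compat_l; lra).
    lra. }
  assert (y 1%nat * (1/2) <= y 1%nat * cos (INR 1 * t)) by (apply Rmult_le_compat_l; lra).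
  lra.
Qed.

Lemma cosine_poly_nonneg (t : R) (n : nat) :
  0 <= t <= PI -> 0 <= y 1%nat + sum_n_m (fun k => y k * cos (INR k * t)) 1 n.
Proof.
  intros Ht. assert (Hy1 : 0 <= y 1%nat) by (apply Hy; lia).
  destruct n as [|n].
  { rewrite Rsum_empty by lia. lra. }
  destruct (Rle_lt_dec t 0) as [H0|H0].
  - assert (0 <= sum_n_m (fun k => y k * cos (INR k * t)) 1 (S n)); [|lra].
    apply Rsum_nonneg. intros k Hk. replace t with 0 by lra.
    rewrite Rmult_0_r, cos_0, Rmult_1_r. apply Hy; lia.
  - destruct (Rle_lt_dec t (PI / 3)).
    + apply cosine_poly_small_angle; [lra|lia].
    + apply cosine_poly_large_angle; [lra|lia].
Qed.


(** Write the terms as [u_k f_k] with [u_k = k y_k] and [f_k = alt_sine_term phi k], whose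
    partial sums lie in [[0, sin phi]].  Summation by parts loses at most [sin phi] times
    the total increase of [u] from index 2 on.  With [q = w_2 y_2], that increase is at most
    [q (n / w_n - 2 / w_2) <= q - u_2], which the gain [u_1 - u_2 >= q - u_2] from the first
    step compensates. *)
Lemma sine_poly_large_angle (phi : R) (n : nat) :
  0 <= phi <= PI / 3 -> (1 <= n)%nat ->
  0 <= sum_n_m (fun k => y k * sin (INR k * (PI - phi))) 1 n.
Proof.
  intros Hphi Hn. assert (Hpi := PI_RGT_0).
  set (F := fun m => sum_n_m (alt_sine_term phi) 1 m).
  assert (HF : forall m, (1 <= m)%nat -> 0 <= F m <= sin phi)
    by (intros; apply alt_sine_sum_bounds; [lra|assumption]).
  assert (HF1 : F 1%nat = sin phi).
  { unfold F. rewrite sum_n_n. unfold alt_sine_term. simpl.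
    rewrite Rmult_1_l. field. }
  assert (Hs : 0 <= sin phi) by (apply sin_ge_0; lra).
  rewrite (Rsum_ext _ (fun k => INR k * y k * alt_sine_term phi k)).
  2: { intros k Hk. rewrite sin_mult_PI_minus by lia. unfold alt_sine_term.
       field. apply not_0_INR; lia. }
  set (q := w 2%nat * y 2%nat).
  destruct Hy as (Hy0 & Hy2 & Hy3). fold q in Hy2.
  assert (Hq : 0 <= q).
  { apply Rmult_le_pos; [|apply Hy0; lia].
    assert (H := weight_ge_2 2 ltac:(lia)); lra. }
  destruct (le_lt_dec n 1) as [H1|H1].
  { replace n with 1%nat by lia. rewrite sum_n_n.
    change (0 <= INR 1 * y 1%nat * alt_sine_term phi 1).
    replace (alt_sine_term phi 1) with (F 1%nat) by (unfold F; apply sum_n_n).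
    rewrite HF1. simpl. rewrite Rmult_1_l. apply Rmult_le_pos; [apply Hy0; lia|lra]. }
  assert (H : INR n * y n * F n + (y 1%nat - q * (INR n / w n)) * sin phi
     <= sum_n_m (fun k => INR k * y k * alt_sine_term phi k) 1 n).
  { clear Hn. induction H1 as [|m Hm IH].
    - assert (Hw2 := weight_ge_2 2 ltac:(lia)).
      assert (HF2 : F 2%nat = sin phi + alt_sine_term phi 2).
      { unfold F. rewrite Rsum_Sr by lia. fold (F 1%nat). rewrite HF1. reflexivity. }
      rewrite Rsum_Sr by lia. rewrite sum_n_n.
      replace (alt_sine_term phi 1) with (sin phi)
        by (rewrite <- HF1; unfold F; apply sum_n_n).
      rewrite HF2. unfold q. apply Req_le. simpl. field. lra.
    - assert (Hm2 : (2 <= m)%nat) by lia.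
      rewrite Rsum_Sr by lia.
      assert (HFm : F (S m) = F m + alt_sine_term phi (S m))
        by (unfold F; rewrite Rsum_Sr by lia; reflexivity).
      assert (Hwm := weight_ge_2 m ltac:(lia)).
      assert (Hwm' := weight_ge_2 (S m) ltac:(lia)).
      destruct (Hw m ltac:(lia)) as (_ & _ & Hp).
      assert (Hqm := dominated_weighted_le m Hm2). fold q in Hqm.
      specialize (Hy3 m Hm2).
      assert (HFb := HF m ltac:(lia)).
      assert (Hdp : 0 <= INR (S m) / w (S m) - INR m / w m).
      { replace (INR (S m) / w (S m) - INR m / w m)
          with ((INR (S m) * w m - INR m * w (S m)) * / (w m * w (S m))) by (field; lra).
        apply Rmult_le_pos; [lra|]. left. apply Rinv_0_lt_compat. nra. }
      set (p := INR m / w m) in *. set (p' := INR (S m) / w (S m)) in *.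
      assert (Hu : INR m * y m = w m * y m * p) by (unfold p; field; lra).
      assert (Hu' : INR (S m) * y (S m) = w (S m) * y (S m) * p') by (unfold p'; field; lra).
      assert (Hp'0 : 0 <= p').
      { unfold p'. apply Rmult_le_pos; [apply pos_INR|].
        left; apply Rinv_0_lt_compat; lra. }
      assert (Hinc : INR (S m) * y (S m) - INR m * y m <= q * (p' - p)).
      { rewrite Hu, Hu'.
        assert (w (S m) * y (S m) * p' <= w m * y m * p') by (apply Rmult_le_compat_r; lra).
        assert (w m * y m * (p' - p) <= q * (p' - p)) by (apply Rmult_le_compat_r; lra).
        lra. }
      assert ((INR (S m) * y (S m) - INR m * y m) * F m <= q * (p' - p) * sin phi).
      { apply Rle_trans with (q * (p' - p) * F m).
        - apply Rmult_le_compat_r; lra.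
        - apply Rmult_le_compat_l; [|lra]. apply Rmult_le_pos; lra. }
      replace (alt_sine_term phi (S m)) with (F (S m) - F m) by (rewrite HFm; ring).
      set (T := sum_n_m _ 1 m) in *. lra. }
  refine (Rle_trans _ _ _ _ H).
  assert (HFn := HF n Hn).
  assert (Hwn := weight_ge_2 n H1).
  assert (Hp : INR n / w n <= 1).
  { destruct (Hw n H1) as (Hwn1 & _).
    apply Rmult_le_reg_r with (w n); [lra|]. unfold Rdiv.
    rewrite Rmult_assoc, Rinv_l by lra. lra. }
  assert (q * (INR n / w n) <= q * 1) by (apply Rmult_le_compat_l; lra).
  apply Rplus_le_le_0_compat.
  - apply Rmult_le_pos; [apply Rmult_le_pos; [apply pos_INR|apply Hy0; lia]|lra].
  - apply Rmult_le_pos; lra.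
Qed.

Lemma sine_poly_nonneg (t : R) (n : nat) :
  0 <= t <= PI -> 0 <= sum_n_m (fun k => y k * sin (INR k * t)) 1 n.
Proof.
  intros Ht.
  destruct n as [|n].
  { rewrite Rsum_empty by lia. lra. }
  destruct (Rle_lt_dec t 0) as [H0|H0].
  - apply Rsum_nonneg. intros k Hk. replace t with 0 by lra.
    rewrite Rmult_0_r, sin_0. lra.
  - destruct (Rle_lt_dec t (2 * PI / 3)).
    + apply sine_poly_small_angle; [lra|lia].
    + rewrite (Rsum_ext _ (fun k => y k * sin (INR k * (PI - (PI - t))))).
      * apply sine_poly_large_angle; [lra|lia].
      * intros k _. do 3 f_equal. ring.
Qed.

End Dominated.

(** * Complex series and their derivatives *)

Lemma Cpow_n_eq (z : C) (k : nat) : @pow_n C_Ring z k = (z ^ k)%C.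
Proof. induction k as [|k IH]; simpl; [reflexivity|]. rewrite IH. reflexivity. Qed.

Lemma is_pseries_C (a : nat -> C) (z l : C) :
  @is_pseries C_AbsRing C_NormedModule a z l <->
  @is_series C_AbsRing C_NormedModule (fun k => (a k * z ^ k)%C) l.
Proof.
  unfold is_pseries.
  assert (E : forall k, @scal C_AbsRing C_NormedModule (@pow_n C_Ring z k) (a k) = (a k * z ^ k)%C).
  { intros k. rewrite Cpow_n_eq. change ((z ^ k * a k)%C = (a k * z ^ k)%C). ring. }
  split; apply is_series_ext; intros k; [apply E|symmetry; apply E].
Qed.

Lemma Re_sum_n (u : nat -> C) (n : nat) :
  Re (@sum_n C_AbelianMonoid u n) = sum_n (fun k => Re (u k)) n.
Proof.
  induction n as [|n IH]; [rewrite !sum_O; reflexivity|].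
  rewrite !sum_Sn, <- IH. reflexivity.
Qed.

Lemma Im_sum_n (u : nat -> C) (n : nat) :
  Im (@sum_n C_AbelianMonoid u n) = sum_n (fun k => Im (u k)) n.
Proof.
  induction n as [|n IH]; [rewrite !sum_O; reflexivity|].
  rewrite !sum_Sn, <- IH. reflexivity.
Qed.

Lemma is_series_C_components (u : nat -> C) (l : C) :
  @is_series C_AbsRing C_NormedModule u l <->
  is_series (fun k => Re (u k)) (Re l) /\ is_series (fun k => Im (u k)) (Im l).
Proof.
  unfold is_series. split.
  - intros H. split.
    + apply filterlim_locally. intros eps.
      generalize (proj1 (filterlim_locally _ _) H eps).
      apply filter_imp. intros n [Hn _]. rewrite <- Re_sum_n. exact Hn.
    + apply filterlim_locally. intros eps.
      generalize (proj1 (filterlim_locally _ _) H eps).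
      apply filter_imp. intros n [_ Hn]. rewrite <- Im_sum_n. exact Hn.
  - intros [H1 H2]. apply filterlim_locally. intros eps.
    generalize (filter_and _ _ (proj1 (filterlim_locally _ _) H1 eps)
                 (proj1 (filterlim_locally _ _) H2 eps)).
    apply filter_imp. intros n [Hn1 Hn2].
    rewrite <- Re_sum_n in Hn1. rewrite <- Im_sum_n in Hn2. split; assumption.
Qed.

Lemma CSeries_unique (u : nat -> C) (l : C) :
  @is_series C_AbsRing C_NormedModule u l -> CSeries u = l.
Proof.
  intros Hl.
  apply (iota_filterlim_locally (V := C_CompleteNormedModule) (sum_n u) l). exact Hl.
Qed.

Lemma CSeries_correct (u : nat -> C) :
  @ex_series C_AbsRing C_NormedModule u ->
  @is_series C_AbsRing C_NormedModule u (CSeries u).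
Proof. intros [l Hl]. rewrite (CSeries_unique u l Hl). exact Hl. Qed.

Lemma ex_series_C_le (u : nat -> C) (b : nat -> R) :
  (forall k, Cmod (u k) <= b k) -> ex_series b ->
  @ex_series C_AbsRing C_NormedModule u.
Proof.
  intros H Hb.
  apply (@ex_series_le C_AbsRing C_CompleteNormedModule u b); [|exact Hb].
  exact H.
Qed.

Lemma Cmod_series_le (u : nat -> C) (b : nat -> R) (l : C) (s : R) :
  (forall k, Cmod (u k) <= b k) ->
  @is_series C_AbsRing C_NormedModule u l -> is_series b s -> Cmod l <= s.
Proof.
  intros H Hu Hb.
  assert (Hl : is_lim_seq (fun n => Cmod (@sum_n C_AbelianMonoid u n)) (Cmod l)).
  { apply (filterlim_comp _ _ _ (sum_n u) Cmod eventually (locally l)); [exact Hu|].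
    exact (@filterlim_norm C_AbsRing C_NormedModule l). }
  assert (Hs : is_lim_seq (sum_n b) s) by exact Hb.
  refine (is_lim_seq_le _ _ _ _ _ Hl Hs).
  intros n. induction n as [|n IH]; [rewrite !sum_O; apply H|].
  rewrite !sum_Sn.
  apply Rle_trans with (1 := Cmod_triangle _ _).
  apply Rplus_le_compat; [exact IH|apply H].
Qed.

Lemma bounded_coeffs_radius (a : nat -> R) (M x : R) :
  (forall k, Rabs (a k) <= M) -> Rabs x < 1 -> Rbar_lt (Rabs x) (CV_radius a).
Proof.
  intros Ha Hx. apply Rbar_lt_le_trans with 1; [exact Hx|].
  apply CV_radius_bounded. exists M. intros n. rewrite pow1, Rmult_1_r. apply Ha.
Qed.

Lemma ex_series_deriv2_geom (r : R) :
  0 <= r < 1 -> ex_series (fun k => INR (S k) * INR (S (S k)) * r ^ k).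
Proof.
  intros Hr.
  assert (H : Rbar_lt (Rabs r) (CV_radius (PS_derive (PS_derive (fun _ => 1))))).
  { rewrite !CV_radius_derive. apply (bounded_coeffs_radius _ 1).
    - intros _. rewrite Rabs_R1. lra.
    - rewrite Rabs_pos_eq; lra. }
  generalize (CV_disk_inside _ _ H). apply ex_series_ext. intros k.
  unfold PS_derive. rewrite Rmult_1_r. apply Rabs_pos_eq.
  apply Rmult_le_pos; [apply Rmult_le_pos; apply pos_INR|apply pow_le; lra].
Qed.

Lemma ex_series_geom_le (r : R) (b : nat -> R) :
  0 <= r < 1 -> (forall k, 0 <= b k <= INR (S k) * INR (S (S k)) * r ^ k) -> ex_series b.
Proof.
  intros Hr Hb.
  apply (ex_series_le (V := R_CompleteNormedModule) b
           (fun k => INR (S k) * INR (S (S k)) * r ^ k)); [|apply ex_series_deriv2_geom, Hr].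
  intros k. change (Rabs (b k) <= INR (S k) * INR (S (S k)) * r ^ k).
  rewrite Rabs_pos_eq; apply Hb.
Qed.

Lemma INR_S_ge_1 (k : nat) : 1 <= INR (S k).
Proof. rewrite S_INR. assert (H := pos_INR k). lra. Qed.

(** The remainder [E_k] satisfies [E_(k+1) = w E_k + k z^(k-1) (w - z)^2].  The left-hand
    factor [r] avoids the exponent [k - 1]. *)
Lemma pow_taylor2_bound (z w : C) (r : R) (k : nat) :
  0 < r -> Cmod z <= r -> Cmod w <= r ->
  r * Cmod (w ^ S k - z ^ S k - INR (S k) * z ^ k * (w - z))%C
    <= INR (S k) * INR (S (S k)) * r ^ k * Cmod (w - z)%C ^ 2.
Proof.
  intros Hr Hz Hw.
  assert (Hd : 0 <= Cmod (w - z)%C ^ 2) by (apply pow_le, Cmod_ge_0).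
  induction k as [|k IH].
  - replace (w ^ 1 - z ^ 1 - INR 1 * z ^ 0 * (w - z))%C with (RtoC 0)
      by (simpl; ring).
    rewrite Cmod_0. simpl in *. nra.
  - replace (w ^ S (S k) - z ^ S (S k) - INR (S (S k)) * z ^ S k * (w - z))%C
      with (w * (w ^ S k - z ^ S k - INR (S k) * z ^ k * (w - z))
            + INR (S k) * z ^ k * ((w - z) * (w - z)))%C.
    2: { rewrite (S_INR (S k)), RtoC_plus. simpl Cpow. ring. }
    apply Rle_trans with (r * (r * Cmod (w ^ S k - z ^ S k - INR (S k) * z ^ k * (w - z))%C
        + INR (S k) * r ^ k * Cmod (w - z)%C ^ 2)).
    { apply Rmult_le_compat_l; [lra|].
      apply Rle_trans with (1 := Cmod_triangle _ _).
      apply Rplus_le_compat.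
      - rewrite Cmod_mult. apply Rmult_le_compat_r; [apply Cmod_ge_0|assumption].
      - rewrite !Cmod_mult, Cmod_pow, Cmod_R, Rabs_pos_eq by apply pos_INR.
        replace (Cmod (w - z)%C * Cmod (w - z)%C) with (Cmod (w - z)%C ^ 2) by ring.
        apply Rmult_le_compat_r; [assumption|].
        apply Rmult_le_compat_l; [apply pos_INR|].
        apply pow_incr. split; [apply Cmod_ge_0|assumption]. }
    rewrite Rmult_plus_distr_l.
    apply Rle_trans with (r * (INR (S k) * INR (S (S k)) * r ^ k * Cmod (w - z)%C ^ 2)
       + r * (INR (S k) * r ^ k * Cmod (w - z)%C ^ 2)).
    { apply Rplus_le_compat_r, Rmult_le_compat_l; [lra|exact IH]. }
    rewrite (S_INR (S (S k))), (S_INR (S k)).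
    set (m := INR (S k)). assert (0 <= m) by apply pos_INR.
    change (r ^ S k) with (r * r ^ k).
    assert (0 <= r * r ^ k * Cmod (w - z)%C ^ 2).
    { apply Rmult_le_pos; [apply Rmult_le_pos; [lra|apply pow_le; lra]|assumption]. }
    nra.
Qed.

Lemma is_derive_of_quadratic_bound (f : C -> C) (z l : C) (d M : R) :
  0 < d -> 0 <= M ->
  (forall w, Cmod (w - z)%C < d -> Cmod (f w - f z - (w - z) * l)%C <= M * Cmod (w - z)%C ^ 2) ->
  @is_derive C_AbsRing C_NormedModule f z l.
Proof.
  intros Hd HM H. split; [apply is_linear_scal_l|].
  intros x Hx.
  apply (@is_filter_lim_locally_unique C_AbsRing (AbsRing_NormedModule C_AbsRing) z x) in Hx.
  subst x.
  intros eps.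
  assert (Hd' : 0 < Rmin d (eps / (M + 1))).
  { apply Rmin_pos; [assumption|]. apply Rdiv_lt_0_compat; [apply cond_pos|lra]. }
  exists (mkposreal _ Hd'). intros w Hw.
  change (Cmod (w - z)%C < Rmin d (eps / (M + 1))) in Hw.
  change (Cmod (f w - f z - (w - z) * l)%C <= eps * Cmod (w - z)%C).
  assert (H1 := Rmin_l d (eps / (M + 1))). assert (H2 := Rmin_r d (eps / (M + 1))).
  apply Rle_trans with (1 := H w ltac:(lra)).
  set (x := Cmod (w - z)%C) in *. assert (Hx : 0 <= x) by apply Cmod_ge_0.
  replace (M * x ^ 2) with (M * x * x) by ring. apply Rmult_le_compat_r; [assumption|].
  assert (x * (M + 1) <= eps).
  { apply Rle_trans with (eps / (M + 1) * (M + 1)); [apply Rmult_le_compat_r; lra|].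
    apply Req_le. field. lra. }
  nra.
Qed.

Section PowerSeries.

Variable a : nat -> C.
Hypothesis Ha : forall k, Cmod (a k) <= 1.

Lemma bounded_pseries_converges (z : C) :
  Cmod z < 1 -> @ex_series C_AbsRing C_NormedModule (fun k => (a k * z ^ k)%C).
Proof.
  intros Hz. assert (Hz0 := Cmod_ge_0 z).
  apply ex_series_C_le with (fun k => Cmod z ^ k).
  - intros k. rewrite Cmod_mult, Cmod_pow.
    assert (0 <= Cmod z ^ k) by (apply pow_le; assumption).
    specialize (Ha k). nra.
  - apply ex_series_geom_le with (Cmod z); [lra|]. intros k.
    assert (0 <= Cmod z ^ k) by (apply pow_le; assumption).
    assert (H1 := INR_S_ge_1 k). assert (H2 := INR_S_ge_1 (S k)).
    assert (1 <= INR (S k) * INR (S (S k))) by nra. nra.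
Qed.

Lemma deriv_pseries_converges (z : C) :
  Cmod z < 1 ->
  @ex_series C_AbsRing C_NormedModule (fun k => (INR (S k) * a (S k) * z ^ k)%C).
Proof.
  intros Hz. assert (Hz0 := Cmod_ge_0 z).
  apply ex_series_C_le with (fun k => INR (S k) * Cmod z ^ k).
  - intros k. rewrite !Cmod_mult, Cmod_pow, Cmod_R.
    rewrite Rabs_pos_eq by apply pos_INR.
    assert (0 <= Cmod z ^ k) by (apply pow_le; assumption).
    assert (0 <= INR (S k)) by apply pos_INR.
    apply Rmult_le_compat_r; [assumption|].
    specialize (Ha (S k)). nra.
  - apply ex_series_geom_le with (Cmod z); [lra|]. intros k.
    assert (0 <= Cmod z ^ k) by (apply pow_le; assumption).
    assert (H1 := INR_S_ge_1 k). assert (H2 := INR_S_ge_1 (S k)).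
    split; [apply Rmult_le_pos; lra|]. apply Rmult_le_compat_r; [assumption|nra].
Qed.

(** The remainder after the linear term is bounded termwise by [pow_taylor2_bound], and
    [sum k (k + 1) r^k] converges for [r < 1]; hence it is quadratic in [w - z]. *)
Lemma is_derive_pseries_C (f : C -> C) (z l : C) :
  (forall w, Cmod w < 1 -> @is_series C_AbsRing C_NormedModule (fun k => (a k * w ^ k)%C) (f w)) ->
  Cmod z < 1 ->
  @is_series C_AbsRing C_NormedModule (fun k => (INR (S k) * a (S k) * z ^ k)%C) l ->
  @is_derive C_AbsRing C_NormedModule f z l.
Proof.
  intros Hf Hz Hl. assert (Hz0 := Cmod_ge_0 z).
  (* a disc around z still contained in the open unit disc *)
  set (r := (1 + Cmod z) / 2).
  destruct (ex_series_deriv2_geom r ltac:(unfold r; lra)) as [s Hs].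
  assert (Hs0 : 0 <= s).
  { rewrite <- (is_series_unique _ _ Hs).
    rewrite <- (Rmult_0_l (Series (fun k => INR (S k) * INR (S (S k)) * r ^ k))).
    rewrite <- Series_scal_l.
    apply Series_le; [|exists s; exact Hs]. intros k. rewrite Rmult_0_l. split; [lra|].
    apply Rmult_le_pos; [apply Rmult_le_pos; apply pos_INR|apply pow_le; unfold r; lra]. }
  apply is_derive_of_quadratic_bound with (r - Cmod z) (s / r).
  - unfold r; lra.
  - apply Rmult_le_pos; [assumption|]. left; apply Rinv_0_lt_compat; unfold r; lra.
  - intros w Hw.
    assert (Hwr : Cmod w <= r).
    { replace w with ((w - z) + z)%C by ring.
      apply Rle_trans with (1 := Cmod_triangle _ _). lra. }
    apply Rmult_le_reg_l with r; [unfold r; lra|].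
    replace (r * (s / r * Cmod (w - z)%C ^ 2)) with (s * Cmod (w - z)%C ^ 2)
      by (field; unfold r; lra).
    rewrite <- (Rabs_pos_eq r) at 1 by (unfold r; lra).
    rewrite <- Cmod_R, <- Cmod_mult.
    apply Cmod_series_le with
      (u := fun k => (r * (a (S k) * (w ^ S k - z ^ S k - INR (S k) * z ^ k * (w - z))))%C)
      (b := fun k => INR (S k) * INR (S (S k)) * r ^ k * Cmod (w - z)%C ^ 2).
    + intros k. rewrite !Cmod_mult, Cmod_R, Rabs_pos_eq by (unfold r; lra).
      assert (HT := pow_taylor2_bound z w r k ltac:(unfold r; lra) ltac:(unfold r; lra) Hwr).
      set (e := Cmod (w ^ S k - z ^ S k - _)%C) in *.
      assert (0 <= e) by apply Cmod_ge_0.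
      assert (Hk := Ha (S k)). assert (Hk0 := Cmod_ge_0 (a (S k))).
      assert (0 < r) by (unfold r; lra).
      assert (Cmod (a (S k)) * e <= 1 * e) by (apply Rmult_le_compat_r; assumption).
      nra.
    + assert (Hw1 : is_series (fun k => (a (S k) * w ^ S k)%C : C_NormedModule) (f w - a O * w ^ 0)%C).
      { apply (is_series_incr_1 (fun k => (a k * w ^ k)%C : C_NormedModule)).
        match goal with |- is_series _ ?x => replace x with (f w) end; [apply Hf; unfold r in *; lra|].
        change (f w = (f w - a O * w ^ 0) + a O * w ^ 0)%C. ring. }
      assert (Hz1 : is_series (fun k => (a (S k) * z ^ S k)%C : C_NormedModule) (f z - a O * z ^ 0)%C).
      { apply (is_series_incr_1 (fun k => (a k * z ^ k)%C : C_NormedModule)).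
        match goal with |- is_series _ ?x => replace x with (f z) end; [apply Hf; assumption|].
        change (f z = (f z - a O * z ^ 0) + a O * z ^ 0)%C. ring. }
      assert (H := is_series_minus _ _ _ _ (is_series_minus _ _ _ _ Hw1 Hz1)
                     (is_series_scal (V := C_NormedModule) (w - z)%C _ _ Hl)).
      apply (is_series_scal (V := C_NormedModule) (RtoC r)) in H.
      match type of H with is_series ?u ?x =>
        replace (r * (f w - f z - (w - z) * l))%C with x end.
      * apply is_series_ext with (2 := H). intros k.
        change ((r * ((a (S k) * w ^ S k - a (S k) * z ^ S k) - (w - z) * (INR (S k) * a (S k) * z ^ k)))%C
         = (r * (a (S k) * (w ^ S k - z ^ S k - INR (S k) * z ^ k * (w - z))))%C). ring.
      * change ((r * (((f w - a O * w ^ 0) - (f z - a O * z ^ 0)) - (w - z) * l))%C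
          = (r * (f w - f z - (w - z) * l))%C). simpl. ring.
    + apply is_series_scal_r. exact Hs.
Qed.

End PowerSeries.

(** * The binomial series of the kernel *)

(** The coefficients of [(1 - z) ^ (- p)], that is, rising factorials of [p] over [k!]. *)
Fixpoint binomial_coeff (p : R) (k : nat) : R :=
  match k with
  | O => 1
  | S k' => binomial_coeff p k' * (p + INR k') / INR (S k')
  end.

Lemma binomial_coeff_bounds (p : R) (k : nat) :
  0 < p <= 2 -> 0 < binomial_coeff p k <= INR (S k).
Proof.
  intros Hp. induction k as [|k [IH1 IH2]]; [simpl; lra|].
  cbn [binomial_coeff].
  assert (Hk := INR_S_ge_1 k). rewrite (S_INR (S k)). rewrite S_INR in *.
  assert (Hk0 := pos_INR k). set (b := binomial_coeff p k) in *. set (x := INR k) in *.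
  split.
  - apply Rdiv_lt_0_compat; [|lra]. apply Rmult_lt_0_compat; lra.
  - apply Rmult_le_reg_r with (x + 1); [lra|].
    unfold Rdiv. rewrite Rmult_assoc, Rinv_l, Rmult_1_r by lra.
    apply Rle_trans with ((x + 1) * (p + x)); [apply Rmult_le_compat_r; lra|nra].
Qed.

Lemma linear_geometric_bounded (r : R) (n : nat) :
  0 <= r < 1 -> INR (S n) * r ^ n <= / (1 - r).
Proof.
  intros Hr.
  assert (H : (1 - r) * (INR (S n) * r ^ n) <= 1 - r ^ S n).
  { induction n as [|n IH]; [simpl; lra|].
    rewrite (S_INR (S n)).
    change (r ^ S (S n)) with (r * r ^ S n).
    assert (0 <= r ^ S n <= 1).
    { split; [apply pow_le; lra|]. rewrite <- (pow1 (S n)). apply pow_incr. lra. }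
    assert (r * ((1 - r) * (INR (S n) * r ^ n)) <= r * (1 - r ^ S n))
      by (apply Rmult_le_compat_l; lra).
    change (r ^ S n) with (r * r ^ n) in *. nra. }
  apply Rmult_le_reg_l with (1 - r); [lra|]. rewrite Rinv_r by lra.
  assert (0 <= r ^ S n) by (apply pow_le; lra). lra.
Qed.

(** The bound makes the radius of convergence at least [1 / s], which exceeds 1; thus the
    endpoint [t = 1] of the ray is interior. *)
Lemma linear_geometric_radius (u : nat -> R) (s t : R) :
  0 <= s < 1 -> (forall k, Rabs (u k) <= INR (S k) * s ^ k) -> Rabs t <= 1 ->
  Rbar_lt (Rabs t) (CV_radius u).
Proof.
  intros Hs Hu Ht.
  (* any radius strictly between 1 and 1/s keeps the terms bounded *)
  set (r := 2 / (1 + s)).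
  assert (Hr : 1 < r).
  { unfold r. apply Rmult_lt_reg_r with (1 + s); [lra|].
    unfold Rdiv. rewrite Rmult_assoc, Rinv_l by lra. lra. }
  apply Rbar_lt_le_trans with r; [simpl; lra|].
  apply CV_radius_bounded. exists (/ (1 - s * r)). intros n.
  assert (Hsr : 0 <= s * r < 1).
  { split; [apply Rmult_le_pos; lra|]. unfold r.
    apply Rmult_lt_reg_r with (1 + s); [lra|].
    replace (s * (2 / (1 + s)) * (1 + s)) with (2 * s) by (field; lra). lra. }
  refine (Rle_trans _ _ _ _ (linear_geometric_bounded (s * r) n Hsr)).
  rewrite Rabs_mult, Rpow_mult_distr, <- Rmult_assoc.
  rewrite (Rabs_pos_eq (r ^ n)) by (apply pow_le; lra).
  apply Rmult_le_compat_r; [apply pow_le; lra|apply Hu].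
Qed.

Lemma Re_Cmult (a b : C) : Re (a * b)%C = Re a * Re b - Im a * Im b.
Proof. reflexivity. Qed.

Lemma Im_Cmult (a b : C) : Im (a * b)%C = Re a * Im b + Im a * Re b.
Proof. reflexivity. Qed.

Lemma Im_le_Cmod (z : C) : Rabs (Im z) <= Cmod z.
Proof.
  apply Rle_trans with (2 := Rmax_Cmod z). apply Rmax_r.
Qed.

(** The arctangent is differentiable on the whole right half plane, while the two branches
    of [Carg] meet on the real axis. *)
Lemma Carg_atan (w : C) : 0 < Re w -> Carg w = atan (Im w / Re w).
Proof.
  intros Hw.
  assert (Hc : cos (atan (Im w / Re w)) = Re w / Cmod w).
  { rewrite cos_atan.
    assert (H : Cmod w = Re w * sqrt (1 + Rsqr (Im w / Re w))).
    { rewrite <- (sqrt_Rsqr (Re w)) at 1 by lra.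
      rewrite <- sqrt_mult by (unfold Rsqr; nra).
      unfold Cmod. f_equal. unfold Rsqr, Re, Im in *. field. lra. }
    rewrite H. field. split; [|lra].
    apply Rgt_not_eq, sqrt_lt_R0. assert (H1 := Rle_0_sqr (Im w / Re w)). lra. }
  assert (Hb := atan_bound (Im w / Re w)). assert (Hpi := PI_RGT_0).
  unfold Carg. rewrite <- Hc.
  assert (Hi : 0 < / Re w) by (apply Rinv_0_lt_compat; assumption).
  destruct (Rle_dec 0 (Im w)) as [H|H].
  - assert (0 <= atan (Im w / Re w)).
    { destruct H as [H|H].
      - left. rewrite <- atan_0. apply atan_increasing. apply Rdiv_lt_0_compat; assumption.
      - rewrite <- H. unfold Rdiv. rewrite Rmult_0_l, atan_0. lra. }
    apply acos_cos. lra.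
  - assert (atan (Im w / Re w) < 0).
    { rewrite <- atan_0. apply atan_increasing. unfold Rdiv. nra. }
    rewrite <- (cos_neg (atan _)), acos_cos; lra.
Qed.

Lemma is_derive_exp_polar (f g : R -> R) (t f' g' : R) :
  is_derive f t f' -> is_derive g t g' ->
  is_derive (fun t => exp (f t) * cos (g t)) t
    (f' * (exp (f t) * cos (g t)) - g' * (exp (f t) * sin (g t))) /\
  is_derive (fun t => exp (f t) * sin (g t)) t
    (f' * (exp (f t) * sin (g t)) + g' * (exp (f t) * cos (g t))).
Proof.
  intros Hf Hg. split.
  - auto_derive.
    + repeat split; eexists; eassumption.
    + rewrite (is_derive_unique (fun t : R => f t) _ _ Hf), (is_derive_unique (fun t : R => g t) _ _ Hg).
      ring.
  - auto_derive.
    + repeat split; eexists; eassumption.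
    + rewrite (is_derive_unique (fun t : R => f t) _ _ Hf), (is_derive_unique (fun t : R => g t) _ _ Hg).
      ring.
Qed.

Section KernelOnRay.

Variables (p : R) (z : C).
Hypothesis Hp : 0 < p <= 2.
Hypothesis Hz : Cmod z < 1.

Let x := Re z.
Let y := Im z.
Let u k := binomial_coeff p k * Re (z ^ k)%C.
Let v k := binomial_coeff p k * Im (z ^ k)%C.

Lemma ray_radius (t : R) :
  0 <= t <= 1 -> Rbar_lt (Rabs t) (CV_radius u) /\ Rbar_lt (Rabs t) (CV_radius v).
Proof.
  intros Ht. assert (Hz0 := Cmod_ge_0 z).
  assert (Hpow : forall k, 0 <= Cmod z ^ k) by (intros; apply pow_le; assumption).
  split; apply linear_geometric_radius with (Cmod z); try lra;
    try (rewrite Rabs_pos_eq; lra);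
    intros k; unfold u, v; rewrite Rabs_mult;
    destruct (binomial_coeff_bounds p k Hp) as [H1 H2];
    rewrite (Rabs_pos_eq (binomial_coeff p k)) by lra;
    (apply Rmult_le_compat; [lra|apply Rabs_pos|assumption|]);
    rewrite <- Cmod_pow; [apply re_le_Cmod|apply Im_le_Cmod].
Qed.

Lemma binomial_coeff_step (k : nat) :
  INR (S k) * binomial_coeff p (S k) = (p + INR k) * binomial_coeff p k.
Proof.
  cbn [binomial_coeff]. field. apply not_0_INR; lia.
Qed.

(** This is [(1 - t z) G' = p z G], where [G] is the binomial series at [t z] and [G'] its
    derivative in [t], with the term [t z G'] moved to the right-hand side and split into
    real and imaginary parts.  On coefficients it is [binomial_coeff_step]. *)
Lemma ray_series_ode (t : R) :
  0 <= t <= 1 ->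
  let G1 := PSeries u t in let G2 := PSeries v t in
  let D1 := PSeries (PS_derive u) t in let D2 := PSeries (PS_derive v) t in
  D1 = x * (p * G1 + t * D1) - y * (p * G2 + t * D2) /\
  D2 = x * (p * G2 + t * D2) + y * (p * G1 + t * D1).
Proof.
  intros Ht. cbv zeta. destruct (ray_radius t Ht) as [Hu Hv].
  assert (H1 := PSeries_correct u t (CV_radius_inside u t Hu)).
  assert (H2 := PSeries_correct v t (CV_radius_inside v t Hv)).
  assert (H3 := PSeries_correct _ t (ex_pseries_derive u t Hu)).
  assert (H4 := PSeries_correct _ t (ex_pseries_derive v t Hv)).
  set (G1 := PSeries u t) in *. set (G2 := PSeries v t) in *.
  set (D1 := PSeries (PS_derive u) t) in *. set (D2 := PSeries (PS_derive v) t) in *.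
  assert (K : forall a G D, is_pseries a t G -> is_pseries (PS_derive a) t D ->
     is_pseries (fun k => (p + INR k) * a k) t (p * G + t * D)).
  { intros a G D Ha Hd.
    assert (H := is_pseries_plus _ _ _ _ _
        (is_pseries_scal p _ _ _ (Rmult_comm _ _) Ha) (is_pseries_incr_1 _ _ _ Hd)).
    refine (is_pseries_ext _ _ _ _ _ H). intros [|k].
    - change (p * a O + 0 = (p + 0) * a O). ring.
    - change (p * a (S k) + INR (S k) * a (S k) = (p + INR (S k)) * a (S k)). ring. }
  assert (KD : forall a b c d (G H : R), is_pseries a t G -> is_pseries b t H ->
     is_pseries (fun k => c * a k + d * b k) t (c * G + d * H)).
  { intros a b c d G H Ha Hb.
    exact (is_pseries_plus _ _ _ _ _ (is_pseries_scal c _ _ _ (Rmult_comm _ _) Ha)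
             (is_pseries_scal d _ _ _ (Rmult_comm _ _) Hb)). }
  assert (K1 := K _ _ _ H1 H3). assert (K2 := K _ _ _ H2 H4).
  split.
  - apply is_pseries_unique.
    replace (x * (p * G1 + t * D1) - y * (p * G2 + t * D2))
      with (x * (p * G1 + t * D1) + (- y) * (p * G2 + t * D2)) by ring.
    refine (is_pseries_ext _ _ _ _ _ (KD _ _ x (-y) _ _ K1 K2)).
    intros k. unfold PS_derive, u, v.
    rewrite <- (Rmult_assoc (INR (S k)) (binomial_coeff p (S k))), binomial_coeff_step.
    rewrite Cpow_S, Re_Cmult. fold x y.
    match goal with |- ?a = ?b => change (@eq R a b) end. ring.
  - apply is_pseries_unique.
    rewrite Rplus_comm.
    refine (is_pseries_ext _ _ _ _ _ (KD _ _ y x _ _ K1 K2)).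
    intros k. unfold PS_derive, u, v.
    rewrite <- (Rmult_assoc (INR (S k)) (binomial_coeff p (S k))), binomial_coeff_step.
    rewrite Cpow_S, Im_Cmult. fold x y.
    match goal with |- ?a = ?b => change (@eq R a b) end. ring.
Qed.

Let D t := (1 - t * x) ^ 2 + (t * y) ^ 2.
Let E1 t := exp (p * (ln (D t) / 2)) * cos (p * atan (- (t * y) / (1 - t * x))).
Let E2 t := exp (p * (ln (D t) / 2)) * sin (p * atan (- (t * y) / (1 - t * x))).

Lemma ray_re_pos (t : R) : 0 <= t <= 1 -> 0 < 1 - t * x.
Proof.
  intros Ht. assert (H := re_le_Cmod z). fold x in H.
  apply Rabs_le_between in H. nra.
Qed.

Lemma ray_norm_pos (t : R) : 0 <= t <= 1 -> 0 < D t.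
Proof.
  intros Ht. assert (H := ray_re_pos t Ht). unfold D.
  assert (0 < (1 - t * x) ^ 2) by (apply pow_lt; assumption).
  assert (0 <= (t * y) ^ 2) by apply pow2_ge_0. lra.
Qed.

(** [E1] and [E2] are the real and imaginary parts of [(1 - t z) ^ p], whose logarithmic
    derivative is [- p z / (1 - t z)]. *)
Lemma ray_power_derive (t : R) :
  0 <= t <= 1 ->
  let L := p * (t * y ^ 2 - (1 - t * x) * x) / D t in
  let A := - p * y / D t in
  is_derive E1 t (L * E1 t - A * E2 t) /\ is_derive E2 t (L * E2 t + A * E1 t).
Proof.
  intros Ht. cbv zeta.
  assert (Hq := ray_re_pos t Ht). assert (HD := ray_norm_pos t Ht).
  assert (HL : is_derive (fun t => p * (ln (D t) / 2)) t (p * (t * y ^ 2 - (1 - t * x) * x) / D t)).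
  { unfold D in *. auto_derive; [lra|]. field. lra. }
  assert (HA : is_derive (fun t => p * atan (- (t * y) / (1 - t * x))) t (- p * y / D t)).
  { unfold D in *. auto_derive; [lra|]. unfold Rsqr. field. split; lra. }
  exact (is_derive_exp_polar _ _ _ _ _ HL HA).
Qed.

(** The product of the series and the power has derivative zero along the ray and is 1 at
    its origin. *)
Lemma ray_series_mul_power_eq_1 :
  PSeries u 1 * E1 1 - PSeries v 1 * E2 1 = 1 /\
  PSeries u 1 * E2 1 + PSeries v 1 * E1 1 = 0.
Proof.
  assert (Hd : forall t, 0 <= t <= 1 ->
     is_derive (fun t => PSeries u t * E1 t - PSeries v t * E2 t) t 0 /\
     is_derive (fun t => PSeries u t * E2 t + PSeries v t * E1 t) t 0).
  { intros t Ht. destruct (ray_radius t Ht) as [Hu Hv].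
    assert (HG1 := is_derive_PSeries u t Hu). assert (HG2 := is_derive_PSeries v t Hv).
    destruct (ray_series_ode t Ht) as [O1 O2]. destruct (ray_power_derive t Ht) as [P1 P2].
    assert (HD := ray_norm_pos t Ht).
    set (G1 := PSeries u) in *. set (G2 := PSeries v) in *.
    set (D1 := PSeries (PS_derive u) t) in *. set (D2 := PSeries (PS_derive v) t) in *.
    assert (HD1 : D1 = p * ((x * G1 t - y * G2 t) * (1 - t * x)
                       - (x * G2 t + y * G1 t) * (t * y)) / D t).
    { apply Rmult_eq_reg_r with (D t); [|lra].
      unfold Rdiv. rewrite Rmult_assoc, Rinv_l, Rmult_1_r by lra.
      unfold D.
      assert (A1 : D1 * (1 - t * x) + t * y * D2 = p * (x * G1 t - y * G2 t)) by lra.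
      assert (A2 : D2 * (1 - t * x) - t * y * D1 = p * (x * G2 t + y * G1 t)) by lra.
      replace (p * ((x * G1 t - y * G2 t) * (1 - t * x) - (x * G2 t + y * G1 t) * (t * y)))
       with ((p * (x * G1 t - y * G2 t)) * (1 - t * x) - (p * (x * G2 t + y * G1 t)) * (t * y))
         by ring.
      rewrite <- A1, <- A2. ring. }
    assert (HD2 : D2 = p * ((x * G1 t - y * G2 t) * (t * y)
                       + (x * G2 t + y * G1 t) * (1 - t * x)) / D t).
    { apply Rmult_eq_reg_r with (D t); [|lra].
      unfold Rdiv. rewrite Rmult_assoc, Rinv_l, Rmult_1_r by lra.
      unfold D.
      assert (A1 : D1 * (1 - t * x) + t * y * D2 = p * (x * G1 t - y * G2 t)) by lra.
      assert (A2 : D2 * (1 - t * x) - t * y * D1 = p * (x * G2 t + y * G1 t)) by lra.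
      replace (p * ((x * G1 t - y * G2 t) * (t * y) + (x * G2 t + y * G1 t) * (1 - t * x)))
       with ((p * (x * G1 t - y * G2 t)) * (t * y) + (p * (x * G2 t + y * G1 t)) * (1 - t * x))
         by ring.
      rewrite <- A1, <- A2. ring. }
    split.
    - auto_derive.
      + repeat split; eexists; eassumption.
      + rewrite (is_derive_unique (fun t : R => G1 t) _ _ HG1), (is_derive_unique (fun t : R => G2 t) _ _ HG2),
          (is_derive_unique (fun t : R => E1 t) _ _ P1), (is_derive_unique (fun t : R => E2 t) _ _ P2), HD1, HD2.
        field. lra.
    - auto_derive.
      + repeat split; eexists; eassumption.
      + rewrite (is_derive_unique (fun t : R => G1 t) _ _ HG1), (is_derive_unique (fun t : R => G2 t) _ _ HG2),
          (is_derive_unique (fun t : R => E1 t) _ _ P1), (is_derive_unique (fun t : R => E2 t) _ _ P2), HD1, HD2.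
        field. lra. }
  assert (HE : E1 0 = 1 /\ E2 0 = 0).
  { unfold E1, E2, D. rewrite !Rmult_0_l, Rminus_0_r, Ropp_0.
    replace (1 ^ 2 + 0 ^ 2) with 1 by ring.
    unfold Rdiv. rewrite ln_1, !Rmult_0_l, atan_0, Rmult_0_r, exp_0, cos_0, sin_0. lra. }
  assert (HG : PSeries u 0 = 1 /\ PSeries v 0 = 0).
  { rewrite !PSeries_0. unfold u, v. simpl. lra. }
  destruct HE as [HE1 HE2]. destruct HG as [HG1 HG2].
  split.
  - assert (H := eq_is_derive _ 0 1 (fun t Ht => proj1 (Hd t Ht)) Rlt_0_1).
    cbv beta in H. rewrite <- H, HE1, HE2, HG1, HG2. ring.
  - assert (H := eq_is_derive _ 0 1 (fun t Ht => proj2 (Hd t Ht)) Rlt_0_1).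
    cbv beta in H. rewrite <- H, HE1, HE2, HG1, HG2. ring.
Qed.

Lemma binomial_series_C :
  @is_series C_AbsRing C_NormedModule (fun k => (binomial_coeff p k * z ^ k)%C)
    (/ Cpower (1 - z) p)%C.
Proof.
  assert (Ht : 0 <= 1 <= 1) by lra.
  destruct (ray_radius 1 Ht) as [Hu Hv].
  assert (H1 := PSeries_correct u 1 (CV_radius_inside u 1 Hu)).
  assert (H2 := PSeries_correct v 1 (CV_radius_inside v 1 Hv)).
  assert (Hq := ray_re_pos 1 Ht). assert (HD := ray_norm_pos 1 Ht).
  assert (HE : Cpower (1 - z)%C p = (E1 1, E2 1)).
  { unfold Cpower, Clog. rewrite Carg_atan.
    2: { unfold x in Hq. simpl. unfold Re in Hq. lra. }
    assert (HL : ln (Cmod (1 - z)%C) = ln (D 1) / 2).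
    { assert (Hs : Cmod (1 - z)%C = sqrt (D 1)).
      { unfold Cmod, D, x, y, Re, Im. f_equal. simpl. ring. }
      rewrite Hs. assert (Hs0 := sqrt_lt_R0 _ HD).
      rewrite <- (sqrt_sqrt (D 1)) at 2 by lra.
      rewrite ln_mult by assumption. field. }
    rewrite HL. unfold Cexp, E1, E2.
    replace (Im (1 - z)%C) with (- (1 * y)) by (unfold y, Im; simpl; ring).
    replace (Re (1 - z)%C) with (1 - 1 * x) by (unfold x, Re; simpl; ring).
    set (l := ln (D 1) / 2). set (a := atan _).
    replace (Re (RtoC p * (l, a))%C) with (p * l) by (simpl; ring).
    replace (Im (RtoC p * (l, a))%C) with (p * a) by (simpl; ring).
    reflexivity. }
  destruct ray_series_mul_power_eq_1 as [O1 O2].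
  set (G1 := PSeries u 1) in *. set (G2 := PSeries v 1) in *.
  assert (HG : (/ Cpower (1 - z) p)%C = (G1, G2)).
  { rewrite HE.
    assert (HP : ((G1, G2) * (E1 1, E2 1))%C = RtoC 1).
    { unfold Cmult, RtoC. simpl. rewrite O1, O2. reflexivity. }
    assert (HN : (E1 1, E2 1) <> RtoC 0).
    { intros E. rewrite E, Cmult_0_r in HP. injection HP. lra. }
    replace (G1, G2) with ((G1, G2) * (E1 1, E2 1) * / (E1 1, E2 1))%C by (field; assumption).
    rewrite HP. ring. }
  rewrite HG. apply is_series_C_components. split.
  - refine (is_series_ext _ _ _ _ H1). intros k.
    change (pow_n 1 k * u k = binomial_coeff p k * fst (z ^ k)%C - 0 * snd (z ^ k)%C).
    rewrite pow_n_pow, pow1. unfold u, Re. ring.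
  - refine (is_series_ext _ _ _ _ H2). intros k.
    change (pow_n 1 k * v k = binomial_coeff p k * snd (z ^ k)%C + 0 * fst (z ^ k)%C).
    rewrite pow_n_pow, pow1. unfold v, Im. ring.
Qed.

End KernelOnRay.

Definition kernel_coeff (p : R) (k : nat) : R :=
  match k with O => 0 | S k' => binomial_coeff p k' end.

Lemma expansion_prestarlike_kernel (gamma : R) :
  0 <= gamma < 1 ->
  expansion_on_disc (fun k => RtoC (kernel_coeff (2 - 2 * gamma) k)) (prestarlike_kernel gamma).
Proof.
  intros Hg z Hz. apply (proj2 (is_pseries_C _ _ _)).
  assert (H := binomial_series_C (2 - 2 * gamma) z ltac:(lra) Hz).
  apply (is_series_scal (V := C_NormedModule) z) in H.
  apply is_series_decr_1.
  match goal with |- is_series _ ?l =>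
    replace l with (prestarlike_kernel gamma z) end.
  - refine (is_series_ext _ _ _ _ H). intros k.
    change ((z * (binomial_coeff (2 - 2 * gamma) k * z ^ k))%C
       = (binomial_coeff (2 - 2 * gamma) k * z ^ S k)%C). simpl. ring.
  - change (prestarlike_kernel gamma z = (prestarlike_kernel gamma z + - (RtoC 0 * z ^ 0))%C).
    ring.
Qed.

(** * From quadrants to starlikeness *)

(** Used with [g k = r ^ k], to pass to the circle of radius [r], and with
    [g k = (1 - gamma) / (k + 1 - gamma)], to pass from [P] to [Q]. *)
Lemma dominated_mult (w y g : nat -> R) :
  tame_weight w -> dominated w y ->
  (forall k, 0 <= g k) -> (forall k, g (S k) <= g k) ->
  dominated w (fun k => y k * g k).
Proof.
  intros Hw (H1 & H2 & H3) Hg Hd. split; [|split].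
  - intros k Hk. apply Rmult_le_pos; auto.
  - assert (Hw2 := weight_ge_2 w Hw 2 ltac:(lia)).
    assert (H0 := H1 2%nat ltac:(lia)). assert (H4 := H1 1%nat ltac:(lia)).
    assert (0 <= w 2%nat * y 2%nat) by (apply Rmult_le_pos; lra).
    rewrite <- Rmult_assoc.
    apply Rle_trans with (w 2%nat * y 2%nat * g 1%nat); [apply Rmult_le_compat_l; auto|].
    apply Rmult_le_compat_r; auto.
  - intros k Hk. rewrite <- !Rmult_assoc.
    assert (Hwk := weight_ge_2 w Hw (S k) ltac:(lia)).
    assert (0 <= w (S k) * y (S k)).
    { apply Rmult_le_pos; [lra|apply H1; lia]. }
    apply Rle_trans with (w (S k) * y (S k) * g k); [apply Rmult_le_compat_l; auto|].
    apply Rmult_le_compat_r; auto.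
Qed.

(** Conjugation reduces points of the lower half disc to angles in [[0, PI]]; the sign [e]
    records it, and is the same for all powers of [z]. *)
Lemma polar_powers (z : C) :
  exists t e, 0 <= t <= PI /\ (e = 1 \/ e = -1) /\
    forall k, (z ^ k)%C = (Cmod z ^ k * cos (INR k * t), e * (Cmod z ^ k * sin (INR k * t))).
Proof.
  assert (H : exists t e, 0 <= t <= PI /\ (e = 1 \/ e = -1) /\
     z = (Cmod z * cos t, e * (Cmod z * sin t))).
  { set (r := Cmod z).
    destruct (Req_dec r 0) as [Hr|Hr].
    { exists 0, 1. assert (Hpi := PI_RGT_0). repeat split; try lra.
      rewrite Hr. apply Cmod_eq_0 in Hr. rewrite Hr. unfold RtoC. f_equal; ring. }
    assert (Hr0 : 0 < r) by (assert (H := Cmod_ge_0 z); fold r in H; lra).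
    assert (Hsq : r ^ 2 = Re z ^ 2 + Im z ^ 2) by apply Cmod2_alt.
    assert (Hc : -1 <= Re z / r <= 1).
    { assert (H := re_le_Cmod z). fold r in H. apply Rabs_le_between in H.
      split; apply Rmult_le_reg_r with r; auto; unfold Rdiv;
        rewrite Rmult_assoc, Rinv_l; lra. }
    set (t := acos (Re z / r)).
    assert (Ht : 0 <= t <= PI) by apply acos_bound.
    assert (Hcos : r * cos t = Re z).
    { unfold t. rewrite cos_acos by assumption. field. assumption. }
    assert (Hs0 : 0 <= sin t) by (apply sin_ge_0; apply Ht).
    assert (Hsin : (r * sin t) ^ 2 = Im z ^ 2).
    { assert (E := sin2_cos2 t). unfold Rsqr in E.
      replace ((r * sin t) ^ 2) with (r ^ 2 * (sin t * sin t)) by ring.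
      replace (sin t * sin t) with (1 - cos t * cos t) by lra.
      replace (r ^ 2 * (1 - cos t * cos t)) with (r ^ 2 - (r * cos t) ^ 2) by ring.
      rewrite Hcos, Hsq. ring. }
    assert (Hrs : 0 <= r * sin t) by (apply Rmult_le_pos; lra).
    rewrite (surjective_pairing z). change (fst z) with (Re z). change (snd z) with (Im z).
    destruct (Rle_lt_dec 0 (Im z)) as [Hi|Hi].
    - exists t, 1. split; [assumption|]. split; [lra|]. rewrite Hcos. f_equal. nra.
    - exists t, (-1). split; [assumption|]. split; [lra|]. rewrite Hcos. f_equal. nra. }
  destruct H as (t & e & Ht & He & Hz).
  exists t, e. split; [assumption|]. split; [assumption|].
  assert (Hee : e * e = 1) by (destruct He as [-> | ->]; ring).
  induction k as [|k IH].
  - simpl. rewrite Rmult_0_l, cos_0, sin_0. unfold RtoC. f_equal; ring.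
  - rewrite Cpow_S, IH. rewrite Hz at 1.
    rewrite S_INR, Rmult_plus_distr_r, Rmult_1_l, cos_plus, sin_plus.
    unfold Cmult. simpl. set (r := Cmod z).
    f_equal; [|ring].
    replace (r * cos t * (r ^ k * cos (INR k * t)) - e * (r * sin t) * (e * (r ^ k * sin (INR k * t))))
     with (r * cos t * (r ^ k * cos (INR k * t)) - (e * e) * (r * sin t) * (r ^ k * sin (INR k * t)))
       by ring.
    rewrite Hee. ring.
Qed.

Definition with_constant_term_1 (y : nat -> R) (k : nat) : R :=
  match k with O => 1 | _ => y k end.

(** On the circle of radius [r] the coefficients [y_k r^k] are dominated again, and the
    first one is at most [r]: the constant term 1 exceeds it by [1 - r], whence strictness
    in the first inequality. *)
Lemma dominated_series_quadrant (w y : nat -> R) (z l : C) (t e : R) :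
  tame_weight w -> dominated w y -> y 1%nat <= 1 -> Cmod z < 1 ->
  0 <= t <= PI -> (e = 1 \/ e = -1) ->
  (forall k, (z ^ k)%C = (Cmod z ^ k * cos (INR k * t), e * (Cmod z ^ k * sin (INR k * t)))) ->
  @is_series C_AbsRing C_NormedModule (fun k => (with_constant_term_1 y k * z ^ k)%C) l ->
  0 < Re l /\ 0 <= e * Im l.
Proof.
  intros Hw Hy Hy1 Hz Ht He Hpow Hl.
  set (r := Cmod z) in *. assert (Hr : 0 <= r) by apply Cmod_ge_0.
  assert (Hyr : dominated w (fun k => y k * r ^ k)).
  { apply dominated_mult; auto.
    - intros k. apply pow_le; assumption.
    - intros k. assert (0 <= r ^ k) by (apply pow_le; assumption). simpl. nra. }
  apply is_series_C_components in Hl. destruct Hl as [Hre Him].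
  assert (Hee : e * e = 1) by (destruct He as [-> | ->]; ring).
  assert (Hy0 : 0 <= y 1%nat) by (apply Hy; lia).
  split.
  - apply Rlt_le_trans with (1 - r); [lra|].
    refine (is_lim_seq_le (fun _ => 1 - r) _ (1 - r) (Re l) _ (is_lim_seq_const _) Hre).
    intros n.
    assert (H := cosine_poly_nonneg w _ Hw Hyr t n Ht).
    unfold sum_n. rewrite (Rsum_Chasles _ 0 0 n) by lia. rewrite sum_n_n.
    rewrite (Rsum_ext _ (fun k => y k * r ^ k * cos (INR k * t)) 1 n).
    2: { intros [|k] Hk; [lia|]. rewrite Hpow. unfold Re, with_constant_term_1, Cmult, RtoC.
         cbn [fst snd]. ring. }
    set (T := sum_n_m _ 1 n) in *.
    replace (Re (with_constant_term_1 y 0 * z ^ 0)%C) with 1 by (simpl; ring).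
    cbv beta in H. rewrite pow_1 in H.
    assert (y 1%nat * r <= 1 * r) by (apply Rmult_le_compat_r; assumption).
    lra.
  - assert (Hlim : is_lim_seq (sum_n (fun k => Im (with_constant_term_1 y k * z ^ k)%C)) (Im l))
      by exact Him.
    assert (H0 := is_lim_seq_scal_l _ e _ Hlim).
    refine (is_lim_seq_le (fun _ => 0) _ 0 (e * Im l) _ (is_lim_seq_const _) H0).
    intros n.
    assert (H := sine_poly_nonneg w _ Hw Hyr t n Ht).
    unfold sum_n. rewrite (Rsum_Chasles _ 0 0 n) by lia. rewrite sum_n_n.
    rewrite (Rsum_ext _ (fun k => e * (y k * r ^ k * sin (INR k * t))) 1 n).
    2: { intros [|k] Hk; [lia|]. rewrite Hpow. unfold Im, with_constant_term_1, Cmult, RtoC.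
         cbn [fst snd]. ring. }
    rewrite Rsum_scal.
    replace (Im (with_constant_term_1 y 0 * z ^ 0)%C) with 0 by (simpl; ring).
    rewrite Rplus_0_l, <- Rmult_assoc, Hee, Rmult_1_l. exact H.
Qed.

Lemma Re_div_pos (a b : C) (e : R) :
  (e = 1 \/ e = -1) ->
  0 < Re a -> 0 < Re b -> 0 <= e * Im a -> 0 <= e * Im b -> 0 < Re (a / b)%C.
Proof.
  destruct a as [a1 a2]. destruct b as [b1 b2]. unfold Re, Im. cbn [fst snd].
  intros He Ha Hb Ha2 Hb2.
  assert (H : 0 <= a2 * b2) by (destruct He as [-> | ->]; nra).
  assert (HD : 0 < b1 ^ 2 + b2 ^ 2) by nra.
  unfold Cdiv, Cmult, Cinv. cbn [fst snd].
  replace (a1 * (b1 / (b1 ^ 2 + b2 ^ 2)) - a2 * (- b2 / (b1 ^ 2 + b2 ^ 2)))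
    with ((a1 * b1 + a2 * b2) / (b1 ^ 2 + b2 ^ 2)) by (field; lra).
  apply Rdiv_lt_0_compat; [|assumption].
  assert (0 < a1 * b1) by (apply Rmult_lt_0_compat; assumption). lra.
Qed.

Lemma is_series_C_at_0 (a : nat -> C) (l : C) :
  @is_series C_AbsRing C_NormedModule (fun k => (a k * 0 ^ k)%C) l -> l = a O.
Proof.
  intros Hl. apply CSeries_unique in Hl. rewrite <- Hl.
  apply CSeries_unique. apply (proj1 (is_pseries_C _ _ _)).
  apply (is_pseries_0 (V := C_NormedModule) a).
Qed.

Lemma class_A0_of_expansion (a : nat -> R) (f : C -> C) :
  (forall k, Rabs (a k) <= 1) -> a O = 0 -> a 1%nat = 1 ->
  expansion_on_disc (fun k => RtoC (a k)) f -> class_A0 f.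
Proof.
  intros Ha Ha0 Ha1 Hf.
  assert (Ha' : forall k, Cmod (RtoC (a k)) <= 1) by (intros k; rewrite Cmod_R; apply Ha).
  assert (Hf' : forall z, Cmod z < 1 ->
     @is_series C_AbsRing C_NormedModule (fun k => (a k * z ^ k)%C) (f z)).
  { intros z Hz. apply (proj1 (is_pseries_C _ _ _)). apply Hf, Hz. }
  assert (H0 : Cmod 0 < 1) by (rewrite Cmod_0; lra).
  split; [|split].
  - intros z Hz. destruct (deriv_pseries_converges _ Ha' z Hz) as [l Hl].
    exists l. apply (is_derive_pseries_C _ Ha' f z l Hf' Hz Hl).
  - rewrite (is_series_C_at_0 _ _ (Hf' _ H0)), Ha0. reflexivity.
  - apply is_C_derive_unique. apply (is_derive_pseries_C _ Ha' f _ _ Hf' H0).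
    destruct (deriv_pseries_converges _ Ha' (RtoC 0) H0) as [l Hl].
    replace (RtoC 1) with l; [exact Hl|].
    rewrite (is_series_C_at_0 (fun k => INR (S k) * a (S k))%C l Hl), Ha1.
    simpl. ring.
Qed.

(** With [h = z Q] and [h' = gamma Q + (1 - gamma) P], the starlike quotient is
    [gamma + (1 - gamma) P / Q], and [P(z)], [Q(z)] lie in the same quadrant. *)
Lemma starlike_of_dominated (gamma : R) (b w : nat -> R) (h : C -> C) :
  0 <= gamma < 1 -> b O = 0 -> b 1%nat = 1 -> tame_weight w ->
  dominated w (fun k => (INR k + 1 - gamma) * b (S k) / (1 - gamma)) ->
  (2 - gamma) * b 2%nat <= 1 - gamma ->
  expansion_on_disc (fun k => RtoC (b k)) h ->
  starlike gamma h.
Proof.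
  intros Hg Hb0 Hb1 Hw Hd Hb2 Hh.
  set (y := fun k => (INR k + 1 - gamma) * b (S k) / (1 - gamma)) in *.
  assert (Hy1 : y 1%nat <= 1).
  { unfold y. simpl. apply Rmult_le_reg_r with (1 - gamma); [lra|].
    unfold Rdiv. rewrite Rmult_assoc, Rinv_l; lra. }
  set (q := fun k => y k * ((1 - gamma) / (INR k + 1 - gamma))).
  assert (Hk : forall k, 0 <= INR k) by apply pos_INR.
  assert (Hfac : forall k, 0 <= (1 - gamma) / (INR k + 1 - gamma) <= 1).
  { intros k. specialize (Hk k). split.
    - apply Rmult_le_pos; [lra|]. left; apply Rinv_0_lt_compat; lra.
    - apply Rmult_le_reg_r with (INR k + 1 - gamma); [lra|].
      unfold Rdiv. rewrite Rmult_assoc, Rinv_l; lra. }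
  assert (Hdq : dominated w q).
  { apply dominated_mult; auto.
    - intros k. apply Hfac.
    - intros k. specialize (Hk k). rewrite S_INR.
      apply Rmult_le_compat_l; [lra|]. apply Rinv_le_contravar; lra. }
  assert (Hqb : forall k, (1 <= k)%nat -> q k = b (S k)).
  { intros k _. specialize (Hk k). unfold q, y. field. lra. }
  assert (Hq1 : q 1%nat <= 1).
  { assert (0 <= y 1%nat) by (apply Hd; lia). specialize (Hfac 1%nat). unfold q. nra. }
  assert (Hb : forall k, Rabs (b k) <= 1).
  { intros [|[|k]]; [rewrite Hb0, Rabs_R0; lra|rewrite Hb1, Rabs_R1; lra|].
    rewrite <- Hqb by lia.
    rewrite Rabs_pos_eq by (apply Hdq; lia).
    assert (H := dominated_INR_le w q Hw Hdq (S k) ltac:(lia)).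
    assert (H1 := INR_S_ge_1 k). assert (0 <= q (S k)) by (apply Hdq; lia). nra. }
  assert (Hb' : forall k, Cmod (RtoC (b k)) <= 1) by (intros k; rewrite Cmod_R; apply Hb).
  assert (Hh' : forall z, Cmod z < 1 ->
     @is_series C_AbsRing C_NormedModule (fun k => (b k * z ^ k)%C) (h z)).
  { intros z Hz. apply (proj1 (is_pseries_C _ _ _)). apply Hh, Hz. }
  assert (Hmain : forall z, Cmod z < 1 -> z <> RtoC 0 ->
     h z <> RtoC 0 /\ gamma < Re (z * C_derive h z / h z)%C).
  { intros z Hz Hz0.
    assert (HDex : exists D : C,
      @is_series C_AbsRing C_NormedModule (fun k => (INR (S k) * b (S k) * z ^ k)%C) D)
      by exact (deriv_pseries_converges _ Hb' z Hz).
    destruct HDex as [D HD].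
    assert (HD' : C_derive h z = D)
      by (apply is_C_derive_unique, (is_derive_pseries_C _ Hb' h z D Hh' Hz HD)).
    set (Q := (h z / z)%C).
    assert (HhQ : h z = (z * Q)%C) by (unfold Q; field; assumption).
    assert (HQ : @is_series C_AbsRing C_NormedModule (fun k => (b (S k) * z ^ k)%C) Q).
    { assert (H : is_series (fun k => (b (S k) * z ^ S k)%C : C_NormedModule) (h z)).
      { apply (is_series_incr_1 (fun k => (b k * z ^ k)%C : C_NormedModule)).
        match goal with |- is_series _ ?x => replace x with (h z) end; [apply Hh', Hz|].
        change (h z = h z + b O * z ^ 0)%C. rewrite Hb0. ring. }
      apply (is_series_scal (V := C_NormedModule) (/ z)%C) in H.
      match type of H with is_series ?u ?x => replace Q with x end.
      - refine (is_series_ext _ _ _ _ H). intros k.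
        change ((/ z * (b (S k) * z ^ S k))%C = (b (S k) * z ^ k)%C).
        rewrite Cpow_S. field. assumption.
      - change ((/ z * h z)%C = Q). unfold Q. field. assumption. }
    set (P := ((D - gamma * Q) / (1 - gamma))%C).
    assert (H1g : (1 - gamma)%C <> RtoC 0).
    { intros E. rewrite <- RtoC_minus in E. apply RtoC_inj in E. lra. }
    assert (HDP : D = (gamma * Q + (1 - gamma) * P)%C) by (unfold P; field; assumption).
    assert (HP : @is_series C_AbsRing C_NormedModule (fun k => (with_constant_term_1 y k * z ^ k)%C) P).
    { assert (H := is_series_scal (V := C_NormedModule) (/ (1 - gamma))%C _ _
          (is_series_minus _ _ _ _ HD (is_series_scal (V := C_NormedModule) (RtoC gamma) _ _ HQ))).
      match type of H with is_series ?u ?x => replace P with x end.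
      - refine (is_series_ext _ _ _ _ H). intros k.
        change ((/ (1 - gamma) * (INR (S k) * b (S k) * z ^ k - gamma * (b (S k) * z ^ k)))%C
          = (with_constant_term_1 y k * z ^ k)%C).
        replace (with_constant_term_1 y k) with ((INR (S k) - gamma) * b (S k) / (1 - gamma)).
        + rewrite RtoC_div, RtoC_mult, !RtoC_minus by lra. field. assumption.
        + destruct k as [|k].
          * simpl with_constant_term_1. rewrite Hb1. simpl. field. lra.
          * unfold with_constant_term_1, y. rewrite (S_INR (S k)). field. lra.
      - change ((/ (1 - gamma) * (D - gamma * Q))%C = P). unfold P. field. assumption. }
    assert (HQ1 : @is_series C_AbsRing C_NormedModule (fun k => (with_constant_term_1 q k * z ^ k)%C) Q).
    { refine (is_series_ext _ _ _ _ HQ). intros [|k].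
      - simpl. rewrite Hb1. reflexivity.
      - unfold with_constant_term_1. rewrite Hqb by lia. reflexivity. }
    destruct (polar_powers z) as (t & e & Ht & He & Hpow).
    destruct (dominated_series_quadrant w y z P t e Hw Hd Hy1 Hz Ht He Hpow HP) as [P1 P2].
    destruct (dominated_series_quadrant w q z Q t e Hw Hdq Hq1 Hz Ht He Hpow HQ1) as [Q1 Q2].
    assert (HQ0 : Q <> RtoC 0).
    { intros E. rewrite E in Q1. simpl in Q1. lra. }
    split.
    - rewrite HhQ. apply Cmult_neq_0; assumption.
    - rewrite HD', HhQ, HDP.
      replace (z * (gamma * Q + (1 - gamma) * P) / (z * Q))%C
        with (gamma + (1 - gamma)%R * (P / Q))%C
        by (rewrite RtoC_minus; field; split; assumption).
      assert (HR := Re_div_pos P Q e He P1 Q1 P2 Q2).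
      replace (Re (gamma + (1 - gamma)%R * (P / Q))%C) with (gamma + (1 - gamma) * Re (P / Q)%C)

        by (generalize (P / Q)%C; intros [d1 d2]; simpl; ring).
      assert (0 < (1 - gamma) * Re (P / Q)%C) by (apply Rmult_lt_0_compat; lra). lra. }
  split; [|split].
  - apply (class_A0_of_expansion b); assumption.
  - intros z Hz Hz0. apply Hmain; assumption.
  - intros z Hz. unfold starlike_quotient.
    destruct (Ceq_dec z (RtoC 0)) as [_|Hz0]; [simpl; lra|].
    apply Hmain; assumption.
Qed.

(** * The coefficient conditions *)

(** Lowering the exponent [tau] of the weight [exp L] to 1 multiplies the two sides by
    [exp (- (tau - 1) L')] and [exp (- (tau - 1) L)], of which the first is the smaller. *)
Lemma exp_weight_cancel (tau L L' s s' : R) :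
  1 <= tau -> L <= L' -> 0 <= s ->
  exp (tau * L') * s' <= exp (tau * L) * s -> exp L' * s' <= exp L * s.
Proof.
  intros Ht HL Hs H.
  replace (exp L' * s') with (exp (- (tau - 1) * L') * (exp (tau * L') * s')).
  2: { rewrite <- Rmult_assoc, <- exp_plus. do 2 f_equal. ring. }
  apply Rle_trans with (exp (- (tau - 1) * L') * (exp (tau * L) * s)).
  { apply Rmult_le_compat_l; [left; apply exp_pos|exact H]. }
  rewrite <- Rmult_assoc, <- exp_plus.
  apply Rmult_le_compat_r; [assumption|].
  destruct (Req_dec (- (tau - 1) * L' + tau * L) L) as [E|E]; [rewrite E; lra|].
  left. apply exp_increasing. nra.
Qed.

Lemma exp_le (a b : R) : a <= b -> exp a <= exp b.
Proof. intros [H|H]; [left; apply exp_increasing, H|rewrite H; lra]. Qed.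

Section Coefficients.

Variables alpha beta lambda mu gamma : R.
Hypothesis halpha : 0 <= alpha.
Hypothesis hbeta : 0 <= beta.
Hypothesis hlambda : 0 <= lambda.
Hypothesis hmu : 0 <= mu.
Hypothesis hlm : 1 <= lambda + mu.
Hypothesis hgamma : 0 <= gamma < 1.

Let log_weight (k : nat) : R :=
  lambda / (lambda + mu) * ln (INR k + alpha) + mu / (lambda + mu) * ln (INR k + beta).

Lemma Rpower_product_eq_log_weight (k : nat) :
  Rpower (INR k + alpha) lambda * Rpower (INR k + beta) mu = exp ((lambda + mu) * log_weight k).
Proof.
  unfold Rpower. rewrite <- exp_plus. f_equal. unfold log_weight. field. lra.
Qed.

Lemma normalised_exponents :
  0 <= lambda / (lambda + mu) /\ 0 <= mu / (lambda + mu) /\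
  lambda / (lambda + mu) + mu / (lambda + mu) = 1.
Proof.
  assert (0 < / (lambda + mu)) by (apply Rinv_0_lt_compat; lra).
  split; [|split]; [apply Rmult_le_pos; lra..|field; lra].
Qed.

Lemma log_weight_incr (k : nat) : (1 <= k)%nat -> log_weight k <= log_weight (S k).
Proof.
  intros Hk. destruct normalised_exponents as (H1 & H2 & _).
  assert (H0 : 1 <= INR k) by (change 1 with (INR 1); apply le_INR; assumption).
  unfold log_weight. rewrite S_INR.
  apply Rplus_le_compat; apply Rmult_le_compat_l; auto; apply ln_le; lra.
Qed.

Lemma log_weight_nonneg (k : nat) : (1 <= k)%nat -> 0 <= log_weight k.
Proof.
  intros Hk. destruct normalised_exponents as (H1 & H2 & _).
  assert (H0 : 1 <= INR k) by (change 1 with (INR 1); apply le_INR; assumption).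
  unfold log_weight.
  assert (A : forall c, 0 <= c -> 0 <= ln (INR k + c)).
  { intros c Hc. rewrite <- ln_1. apply ln_le; lra. }
  apply Rplus_le_le_0_compat; apply Rmult_le_pos; auto.
Qed.

(** Each property holds for the factors [k + alpha] and [k + beta] and is inherited by their
    weighted geometric mean. *)
Lemma tame_weight_of_log_weight : tame_weight (fun k => exp (log_weight k)).
Proof.
  intros k Hk. destruct normalised_exponents as (H1 & H2 & H3).
  assert (H0 : 2 <= INR k) by (change 2 with (INR 2); apply le_INR; assumption).
  set (l := lambda / (lambda + mu)) in *. set (m := mu / (lambda + mu)) in *.
  split; [|split].
  - rewrite <- (exp_ln (INR k)) by lra. apply exp_le.
    assert (A : forall c, 0 <= c -> ln (INR k) <= ln (INR k + c)) by (intros; apply ln_le; lra).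
    unfold log_weight. fold l m.
    assert (l * ln (INR k) <= l * ln (INR k + alpha)) by (apply Rmult_le_compat_l; auto).
    assert (m * ln (INR k) <= m * ln (INR k + beta)) by (apply Rmult_le_compat_l; auto).
    replace (ln (INR k)) with (l * ln (INR k) + m * ln (INR k)).
    + lra.
    + rewrite <- Rmult_plus_distr_r, H3. ring.
  - apply exp_le, log_weight_incr. lia.
  - rewrite <- (exp_ln (INR k)) at 1 by lra.
    rewrite <- (exp_ln (INR (S k))) at 1 by (rewrite S_INR; lra).
    rewrite <- !exp_plus. apply exp_le. rewrite S_INR.
    assert (A : forall c, 0 <= c ->
        ln (INR k) + ln (INR k + 1 + c) <= ln (INR k + 1) + ln (INR k + c)).
    { intros c Hc. rewrite <- !ln_mult by lra. apply ln_le; nra. }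
    unfold log_weight. fold l m. rewrite S_INR.
    assert (B1 := Rmult_le_compat_l l _ _ H1 (A alpha halpha)).
    assert (B2 := Rmult_le_compat_l m _ _ H2 (A beta hbeta)).
    replace (ln (INR k)) with ((l + m) * ln (INR k)) by (rewrite H3; ring).
    replace (ln (INR k + 1)) with ((l + m) * ln (INR k + 1)) by (rewrite H3; ring).
    lra.
Qed.

(** Equality holds at [k = 0], and the right-hand side is nondecreasing because
    [(k + 2 - gamma) (k + 2 - 2 gamma) >= (k + 1 - gamma) (k + 1)].  Thus [y_k >= a_(k+1)],
    which bounds [a]. *)
Lemma kernel_coeff_lower (k : nat) :
  1 - gamma <= (INR k + 1 - gamma) * binomial_coeff (2 - 2 * gamma) k.
Proof.
  induction k as [|k IH]; [simpl; lra|].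
  apply Rle_trans with (1 := IH). cbn [binomial_coeff]. rewrite S_INR.
  assert (Hk := pos_INR k). set (x := INR k) in *.
  destruct (binomial_coeff_bounds (2 - 2 * gamma) k ltac:(lra)) as [Hb _].
  set (b := binomial_coeff _ k) in *.
  apply Rmult_le_reg_r with (x + 1); [lra|].
  replace ((x + 1 + 1 - gamma) * (b * (2 - 2 * gamma + x) / (x + 1)) * (x + 1))
    with ((x + 1 + 1 - gamma) * (2 - 2 * gamma + x) * b) by (field; lra).
  replace ((x + 1 - gamma) * b * (x + 1)) with ((x + 1 - gamma) * (x + 1) * b) by ring.
  apply Rmult_le_compat_r; [lra|]. nra.
Qed.

Variable a : nat -> R.
Hypothesis ha_pos : forall k, 0 <= a k.
Hypothesis ha0 : a O = 0.
Hypothesis ha1 : a 1%nat = 1.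
Hypothesis h1 :
  Rpower (2 + alpha) lambda * Rpower (2 + beta) mu * (3 - gamma) * (3 - 2 * gamma) * a 3%nat
    <= 2 * (2 - gamma) * a 2%nat <= a 1%nat.
Hypothesis h2 : forall k : nat, (2 <= k)%nat ->
  Rpower (INR k + 1 + alpha) lambda * Rpower (INR k + 1 + beta) mu
    * (INR k + 2 - gamma) * (INR k + 2 - 2 * gamma) * a (k + 2)%nat
  <= Rpower (INR k + alpha) lambda * Rpower (INR k + beta) mu
    * (INR k + 1 - gamma) * (INR k + 1) * a (k + 1)%nat.

Let b (k : nat) : R := kernel_coeff (2 - 2 * gamma) k * a k.
Let y (k : nat) : R := (INR k + 1 - gamma) * b (S k) / (1 - gamma).

(** The factor [(k + 2 - 2 gamma) / (k + 1)] that turns [c_(k+1)] into [c_(k+2)] is the one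
    in the hypothesis [h2], so [h1] and [h2] are the domination of [y] by the weight with the
    original exponents. *)
Lemma dominated_coefficients : dominated (fun k => exp (log_weight k)) y.
Proof.
  assert (Hg : 0 < / (1 - gamma)) by (apply Rinv_0_lt_compat; lra).
  assert (Hy0 : forall k, 0 <= y k).
  { intros k. unfold y, b. assert (H := pos_INR k).
    destruct (binomial_coeff_bounds (2 - 2 * gamma) k ltac:(lra)) as [Hb _].
    apply Rmult_le_pos; [|lra]. apply Rmult_le_pos; [lra|].
    apply Rmult_le_pos; [simpl; lra|apply ha_pos]. }
  split; [|split].
  - intros k _. apply Hy0.
  - rewrite <- (Rmult_1_l (y 1%nat)), <- exp_0.
    apply exp_weight_cancel with (lambda + mu); auto.
    + apply log_weight_nonneg; lia.
    + rewrite <- Rpower_product_eq_log_weight, Rmult_0_r, exp_0, Rmult_1_l.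
      replace (INR 2) with 2 by (simpl; ring).
      replace (y 1%nat) with (2 * (2 - gamma) * a 2%nat)
        by (unfold y, b; simpl; field; lra).
      replace (y 2%nat) with ((3 - gamma) * (3 - 2 * gamma) * a 3%nat)
        by (unfold y, b; simpl; field; lra).
      rewrite <- !Rmult_assoc. apply h1.
  - intros k Hk.
    apply exp_weight_cancel with (lambda + mu); auto.
    + apply log_weight_incr; lia.
    + rewrite <- !Rpower_product_eq_log_weight.
      specialize (h2 k Hk).
      replace (k + 2)%nat with (S (S k)) in h2 by lia.
      replace (k + 1)%nat with (S k) in h2 by lia.
      assert (Hk0 := pos_INR k). rewrite (S_INR k).
      destruct (binomial_coeff_bounds (2 - 2 * gamma) k ltac:(lra)) as [Hb _].
      set (W := Rpower (INR k + alpha) lambda * Rpower (INR k + beta) mu) in *.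
      set (W' := Rpower (INR k + 1 + alpha) lambda * Rpower (INR k + 1 + beta) mu) in *.
      set (c := binomial_coeff (2 - 2 * gamma) k / ((INR k + 1) * (1 - gamma))).
      assert (Hc : 0 <= c).
      { apply Rmult_le_pos; [lra|]. left; apply Rinv_0_lt_compat, Rmult_lt_0_compat; lra. }
      replace (W' * y (S k))
        with (c * (W' * (INR k + 2 - gamma) * (INR k + 2 - 2 * gamma) * a (S (S k)))).
      2: { unfold c, y, b, kernel_coeff. cbn [binomial_coeff]. rewrite S_INR. field. lra. }
      replace (W * y k)
        with (c * (W * (INR k + 1 - gamma) * (INR k + 1) * a (S k))).
      2: { unfold c, y, b, kernel_coeff. field. lra. }
      apply Rmult_le_compat_l; assumption.
Qed.

Lemma first_coefficient_le_1 : y 1%nat <= 1.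
Proof.
  replace (y 1%nat) with (2 * (2 - gamma) * a 2%nat)
    by (unfold y, b; simpl; field; lra).
  rewrite <- ha1. apply h1.
Qed.

Lemma coefficient_le_1 (k : nat) : 0 <= a k <= 1.
Proof.
  split; [apply ha_pos|].
  destruct k as [|[|k]]; [lra|lra|].
  apply Rle_trans with (y (S k)).
  - unfold y, b, kernel_coeff. rewrite <- Rmult_assoc.
    assert (H := kernel_coeff_lower (S k)).
    set (c := (INR (S k) + 1 - gamma) * binomial_coeff _ _) in *.
    apply Rmult_le_reg_r with (1 - gamma); [lra|].
    unfold Rdiv. rewrite Rmult_assoc, Rinv_l, Rmult_1_r by lra.
    rewrite Rmult_comm. apply Rmult_le_compat_r; [apply ha_pos|exact H].
  - apply Rle_trans with (2 := first_coefficient_le_1).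
    assert (H := dominated_INR_le _ _ tame_weight_of_log_weight dominated_coefficients (S k) ltac:(lia)).
    assert (H1 := INR_S_ge_1 k).
    assert (0 <= y (S k)) by (apply dominated_coefficients; lia). nra.
Qed.

Lemma coefficient_series_converges (z : C) :
  unit_disc z -> @ex_series C_AbsRing C_NormedModule (fun k => (a k * z ^ k)%C).
Proof.
  intros Hz. apply (bounded_pseries_converges (fun k => RtoC (a k))); [|exact Hz].
  intros k. rewrite Cmod_R, Rabs_pos_eq; apply coefficient_le_1.
Qed.

Lemma prestarlike_of_expansion (f : C -> C) :
  expansion_on_disc (fun k => RtoC (a k)) f -> prestarlike gamma f.
Proof.
  intros Hf. split.
  - apply (class_A0_of_expansion a); auto.
    intros k. rewrite Rabs_pos_eq; apply coefficient_le_1.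
  - set (h := fun z => CSeries (fun k => (b k * z ^ k)%C)).
    assert (Hb : forall k, Cmod (RtoC (b k)) <= 1).
    { intros [|k].
      { unfold b. simpl. rewrite Rmult_0_l, Cmod_0. lra. }
      rewrite Cmod_R.
      assert (Hk := pos_INR k).
      assert (Hby : 0 <= b (S k)).
      { apply Rmult_le_pos; [|apply ha_pos].
        destruct (binomial_coeff_bounds (2 - 2 * gamma) k ltac:(lra)). simpl. lra. }
      rewrite Rabs_pos_eq by assumption.
      destruct k as [|k]; [unfold b; simpl; rewrite ha1; lra|].
      assert (Hy := dominated_INR_le _ _ tame_weight_of_log_weight dominated_coefficients (S k) ltac:(lia)).
      assert (Hy1 := first_coefficient_le_1). assert (HS := INR_S_ge_1 k).
      assert (Hle : b (S (S k)) <= y (S k)).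
      { apply Rmult_le_reg_r with (1 - gamma); [lra|]. unfold y, Rdiv.
        rewrite Rmult_assoc, Rinv_l, Rmult_1_r by lra.
        rewrite Rmult_comm. apply Rmult_le_compat_r; lra. }
      nra. }
    assert (Hh : expansion_on_disc (fun k => RtoC (b k)) h).
    { intros z Hz. apply (proj2 (is_pseries_C _ _ _)). apply CSeries_correct.
      apply (bounded_pseries_converges (fun k => RtoC (b k)) Hb z Hz). }
    exists h. split.
    + exists (fun k => RtoC (kernel_coeff (2 - 2 * gamma) k)), (fun k => RtoC (a k)).
      split; [apply expansion_prestarlike_kernel, hgamma|]. split; [exact Hf|].
      intros z Hz. refine (is_series_ext _ _ _ _ (Hh z Hz)).
      intros k. unfold b. rewrite RtoC_mult. reflexivity.
    + apply (starlike_of_dominated gamma b (fun k => exp (log_weight k))); auto.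
      * unfold b. simpl. ring.
      * unfold b. rewrite ha1. simpl. ring.
      * exact tame_weight_of_log_weight.
      * exact dominated_coefficients.
      * unfold b. simpl.
        assert (H := proj2 h1). rewrite ha1 in H.
        replace ((2 - gamma) * (1 * (2 - 2 * gamma + 0) / 1 * a 2%nat))
          with ((1 - gamma) * (2 * (2 - gamma) * a 2%nat)) by field.
        rewrite <- (Rmult_1_r (1 - gamma)) at 2. apply Rmult_le_compat_l; lra.
Qed.

End Coefficients.

Lemma is_series_finite_support (u : nat -> C) (n : nat) :
  (forall k, (n < k)%nat -> u k = RtoC 0) ->
  @is_series C_AbsRing C_NormedModule u (@sum_n C_AbelianMonoid u n).
Proof.
  intros Hu. unfold is_series.
  apply (filterlim_ext_loc (fun _ => @sum_n C_AbelianMonoid u n)).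
  - exists n. intros m Hm. induction Hm as [|m Hm IH]; [reflexivity|].
    rewrite sum_Sn, <- IH, Hu by lia.
    symmetry. apply Cplus_0_r.
  - apply filterlim_const.
Qed.

Theorem theorem2p3 (alpha beta lambda mu gamma : R) (a : nat -> R)
  (halpha : 0 <= alpha) (hbeta : 0 <= beta)
  (hlambda : 0 <= lambda) (hmu : 0 <= mu) (hlm : 1 <= lambda + mu)
  (hgamma : 0 <= gamma < 1)
  (hpos : forall k : nat, (1 <= k)%nat -> 0 < a k)
  (ha1 : a 1%nat = 1)
  (h1 : Rpower (2 + alpha) lambda * Rpower (2 + beta) mu
          * (3 - gamma) * (3 - 2 * gamma) * a 3%nat
        <= 2 * (2 - gamma) * a 2%nat <= a 1%nat)
  (h2 : forall k : nat, (2 <= k)%nat ->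
        Rpower (INR k + 1 + alpha) lambda * Rpower (INR k + 1 + beta) mu
          * (INR k + 2 - gamma) * (INR k + 2 - 2 * gamma) * a (k + 2)%nat
        <= Rpower (INR k + alpha) lambda * Rpower (INR k + beta) mu
          * (INR k + 1 - gamma) * (INR k + 1) * a (k + 1)%nat) :
  (forall n : nat, (1 <= n)%nat ->
     prestarlike gamma
       (fun z : C =>
          (z + @sum_n_m C_AbelianMonoid (fun k : nat => RtoC (a k) * z ^ k) 2 n)%C))
  /\
  (forall z : C, unit_disc z ->
     @ex_series C_AbsRing C_NormedModule
       (fun k : nat => (RtoC (a (k + 2)%nat) * z ^ (k + 2))%C))
  /\
  prestarlike gamma
    (fun z : C =>
       (z + CSeries (fun k : nat => RtoC (a (k + 2)%nat) * z ^ (k + 2)))%C).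
Proof.
  split.
  - intros n Hn.
    set (a' := fun k => if andb (1 <=? k)%nat (k <=? n)%nat then a k else 0).
    assert (Hin : forall k, (1 <= k <= n)%nat -> a' k = a k).
    { intros k Hk. unfold a'. rewrite (proj2 (Nat.leb_le 1 k)), (proj2 (Nat.leb_le k n)) by lia.
      reflexivity. }
    assert (Hout : forall k, (n < k)%nat -> a' k = 0).
    { intros k Hk. unfold a'. rewrite (proj2 (Nat.leb_gt k n)) by lia.
      rewrite Bool.andb_false_r. reflexivity. }
    assert (Hpos' : forall k, 0 <= a' k).
    { intros k. unfold a'. destruct (1 <=? k)%nat eqn:E; [|simpl; lra].
      apply Nat.leb_le in E. destruct (k <=? n)%nat; simpl; [left; auto|lra]. }
    assert (HR : forall u v : R, 0 <= Rpower u lambda * Rpower v mu).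
    { intros u v. apply Rmult_le_pos; left; apply exp_pos. }
    apply (prestarlike_of_expansion alpha beta lambda mu gamma halpha hbeta hlambda hmu hlm
             hgamma a' Hpos').
    + reflexivity.
    + rewrite Hin by lia. exact ha1.
    + rewrite (Hin 1%nat) by lia.
      assert (H20 := Hpos' 2%nat).
      destruct (le_lt_dec 3 n) as [H3|H3].
      * rewrite !Hin by lia. exact h1.
      * rewrite (Hout 3%nat) by lia. rewrite Rmult_0_r.
        split; [apply Rmult_le_pos; lra|].
        destruct (le_lt_dec 2 n) as [H2|H2].
        { rewrite Hin by lia. apply h1. }
        rewrite Hout by lia. lra.
    + intros k Hk. assert (H0 := pos_INR k).
      destruct (le_lt_dec (k + 2) n) as [H|H].
      * rewrite !Hin by lia. apply h2, Hk.
      * rewrite (Hout (k + 2)%nat) by lia. rewrite Rmult_0_r.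
        apply Rmult_le_pos; [|apply Hpos'].
        apply Rmult_le_pos; [|lra]. apply Rmult_le_pos; [apply HR|lra].
    + intros z _. apply (proj2 (is_pseries_C _ _ _)).
      assert (HS := is_series_finite_support (fun k => (a' k * z ^ k)%C) n).
      match goal with |- is_series _ ?l =>
        replace l with (@sum_n C_AbelianMonoid (fun k => (a' k * z ^ k)%C) n) end.
      { apply HS. intros k Hk. rewrite Hout by assumption. ring. }
      unfold sum_n. rewrite (sum_n_m_Chasles (G := C_AbelianMonoid) _ 0 1 n) by lia.
      rewrite sum_n_Sm, sum_n_n by lia.
      rewrite (sum_n_m_ext_loc (G := C_AbelianMonoid) _ (fun k : nat => (RtoC (a k) * z ^ k)%C) 2 n).
      2: { intros k Hk. rewrite Hin by lia. reflexivity. }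
      set (T := sum_n_m _ 2 n).
      change (((a' O * z ^ 0 + a' 1%nat * z ^ 1) + T)%C = (z + T)%C).
      rewrite (Hin 1%nat) by lia. rewrite ha1. unfold a'. simpl. ring.
  - set (a' := fun k => match k with O => 0 | _ => a k end).
    assert (Hpos' : forall k, 0 <= a' k).
    { intros [|k]; [simpl; lra|]. left. apply hpos. lia. }
    assert (h2' : forall k : nat, (2 <= k)%nat ->
        Rpower (INR k + 1 + alpha) lambda * Rpower (INR k + 1 + beta) mu
          * (INR k + 2 - gamma) * (INR k + 2 - 2 * gamma) * a' (k + 2)%nat
        <= Rpower (INR k + alpha) lambda * Rpower (INR k + beta) mu
          * (INR k + 1 - gamma) * (INR k + 1) * a' (k + 1)%nat).
    { intros k Hk. specialize (h2 k Hk).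
      replace (k + 2)%nat with (S (S k)) in * by lia.
      replace (k + 1)%nat with (S k) in * by lia. exact h2. }
    assert (Hconv : forall z, unit_disc z -> exists l : C,
        @is_series C_AbsRing C_NormedModule (fun k => (a' k * z ^ k)%C) l)
      by exact (coefficient_series_converges alpha beta lambda mu gamma halpha hbeta hlambda
              hmu hlm hgamma a' Hpos' eq_refl ha1 h1 h2').
    assert (Htail : forall z l : C, @is_series C_AbsRing C_NormedModule (fun k => (a' k * z ^ k)%C) l ->
       @is_series C_AbsRing C_NormedModule (fun k => (RtoC (a (k + 2)%nat) * z ^ (k + 2))%C) (l - z)%C).
    { intros z l Hl.
      apply (is_series_ext (fun k => (a' (S (S k)) * z ^ S (S k))%C : C_NormedModule)).
      { intros k. replace (k + 2)%nat with (S (S k)) by lia. reflexivity. }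
      apply (is_series_incr_1 (fun k => (a' (S k) * z ^ S k)%C : C_NormedModule)).
      apply (is_series_incr_1 (fun k => (a' k * z ^ k)%C : C_NormedModule)).
      match goal with |- is_series _ ?x => replace x with l end; [exact Hl|].
      change (l = (l - z + a' 1%nat * z ^ 1) + a' O * z ^ 0)%C.
      unfold a'. rewrite ha1. simpl. ring. }
    split.
    + intros z Hz. destruct (Hconv z Hz) as [l Hl]. exists (l - z)%C. apply Htail, Hl.
    + apply (prestarlike_of_expansion alpha beta lambda mu gamma halpha hbeta hlambda hmu hlm
             hgamma a' Hpos' eq_refl ha1 h1 h2').
      intros z Hz. apply (proj2 (is_pseries_C _ _ _)).
      destruct (Hconv z Hz) as [l Hl].
      rewrite (CSeries_unique _ _ (Htail z l Hl)).
      assert (E : (z + (l - z))%C = l) by ring. rewrite E. exact Hl.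
Qed.
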